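(* Let $u\in\{3,5,7,\dots\}$ and assume that the fusion coefficients of the ($C_2$-cofinite, rational) vertex operator algebra $\mathsf{BP}(u,2)$ are given by the Verlinde formula, i.e. $\mathbb N^{\mathsf{BP}\,\nu}_{\lambda,\mu}=\sum_{\Lambda\in P_\ge^{u-3}}\mathsf S^{\mathsf{BP}}_{\lambda,\Lambda}\mathsf S^{\mathsf{BP}}_{\mu,\Lambda}(\mathsf S^{\mathsf{BP}}_{\nu,\Lambda})^*/\mathsf S^{\mathsf{BP}}_{\varnothing,\Lambda}$. Then the fusion rules of the irreducible $\mathsf{BP}(u,2)$-modules take the form $$\mathcal H_\lambda\boxtimes\mathcal H_\mu\cong\bigoplus_{\nu\in P_\ge^{u-3}}\mathbb N^{\mathsf{BP}\,\nu}_{\lambda,\mu}\,\mathcal H_\nu,\qquad\lambda,\mu\in P_\ge^{u-3},$$ where the fusion coefficients coincide with those of $\mathsf A_2(u,1)$: $$\mathbb N^{\mathsf{BP}\,\nu}_{\lambda,\mu}=\widehat{\mathbb N}^{(u,1)\,\nu}_{\lambda,\mu},\qquad\lambda,\mu,\nu\in P_\ge^{u-3}.$$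
   Context: $P_\ge^{u-3}$ is the set of $\widehat{\mathfrak{sl}}_3$-weights $\lambda=(\lambda_0,\lambda_1,\lambda_2)$ whose Dynkin labels are nonnegative integers with sum $u-3$; $\varnothing=(u-3,0,0)$. In pairings, $\lambda+\rho$ means $(\lambda_1+1)\omega_1+(\lambda_2+1)\omega_2\in\mathfrak h^*$ (fundamental weights of $\mathfrak{sl}_3$), with $\langle\cdot,\cdot\rangle$ normalised so that roots have norm squared $2$. $S_3$ is the Weyl group of $\mathfrak{sl}_3$, and $*$ is complex conjugation. $\mathsf A_2(u,1)$ is the simple affine vertex operator algebra of $\mathfrak{sl}_3$ at level $u-3$. Its S-matrix is $\widehat{\mathsf S}^{(u,1)}_{\lambda,\lambda'}=\frac{-\mathrm i}{\sqrt3u}\sum_{w\in S_3}\det(w)\mathrm e^{-2\pi\mathrm i\langle w(\lambda+\rho),\lambda'+\rho\rangle/u}$ and its fusion coefficients are $\widehat{\mathbb N}^{(u,1)\,\nu}_{\lambda,\mu}=\sum_{\Lambda\in P_\ge^{u-3}}\widehat{\mathsf S}^{(u,1)}_{\lambda,\Lambda}\widehat{\mathsf S}^{(u,1)}_{\mu,\Lambda}(\widehat{\mathsf S}^{(u,1)}_{\nu,\Lambda})^*/\widehat{\mathsf S}^{(u,1)}_{\varnothing,\Lambda}$. $\mathsf{BP}(u,2)$ is the simple quotient of the Bershadsky–Polyakov vertex operator algebra $\mathsf{BP}^k$, $k=-3+\frac u2$, strongly generated by $J,L,G^+,G^-$ of conformal weights $1,2,2,1$ ($L$ the conformal vector) with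 $J(z)J(w)\sim\frac{2k+3}{3(z-w)^2}$, $J(z)G^\pm(w)\sim\frac{\pm G^\pm(w)}{z-w}$, $G^\pm(z)G^\pm(w)\sim0$, $G^\pm$ primary for $L$, $L(z)J(w)\sim\frac{2k+3}{3(z-w)^3}+\frac{J(w)}{(z-w)^2}+\frac{\partial J(w)}{z-w}$, $G^+(z)G^-(w)\sim\frac{(k+1)(2k+3)}{(z-w)^3}+\frac{3(k+1)J(w)}{(z-w)^2}+\frac{3:JJ:(w)+k\partial J(w)-(k+3)L(w)}{z-w}$ and central charge $-\frac{4(k+1)(2k+3)}{k+3}$. $\mathcal H_\lambda$ is its irreducible module generated by a vector annihilated by all positive modes and $G^+_0$, with $J_0$-eigenvalue $j_\lambda=-\frac{\lambda_1-\lambda_2}3$ and $L_0$-eigenvalue $\frac{(\lambda_1-\lambda_2)(\lambda_1-\lambda_2-u)+3(\lambda_1+\lambda_2)(\lambda_1+\lambda_2-u+4)}{6u}$; these exhaust the irreducibles, $\mathcal H_\varnothing$ being the vacuum module. The S-matrix of their characters is $\mathsf S^{\mathsf{BP}}_{\lambda,\lambda'}=\frac{\mathrm i}{\sqrt3u}\mathrm e^{2\pi\mathrm i(j_\lambda+j_{\lambda'}-u/3)}\sum_{w\in S_3}\det(w)\mathrm e^{-4\pi\mathrm i\langle w(\lambda+\rho),\lambda'+\rho\rangle/u}$. $\boxtimes$ is the fusion product. *)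

(* Defs.v *)
From HB Require Import structures.
From mathcomp Require Import all_boot all_order all_fingroup all_algebra.
From mathcomp Require Import all_classical all_reals all_analysis.
From mathcomp Require Export complex.

Set Implicit Arguments.
Unset Strict Implicit.
Unset Printing Implicit Defensive.

Import Order.TTheory GRing.Theory Num.Theory.

Local Open Scope classical_set_scope.
Local Open Scope ring_scope.

Definition subspace (F : fieldType) (M : lmodType F) (S : set M) : Prop :=
  S 0 /\ forall (c : F) (x y : M), S x -> S y -> S (c *: x + y).

Definition lin_span (F : fieldType) (M : lmodType F) (A : set M) : set M :=
  [set v | exists (n : nat) (c : 'I_n -> F) (x : 'I_n -> M),
     (forall i, A (x i)) /\ v = \sum_(i < n) c i *: x i].

Definition fin_dim (F : fieldType) (M : lmodType F) (S : set M) : Prop :=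
  exists s : seq M, S `<=` lin_span [set x | x \in s].

(* M is the direct sum of the family of subspaces S, which may be infinite. *)
Definition internal_dsum (F : fieldType) (M : lmodType F) (I : choiceType)
    (S : I -> set M) : Prop :=
  [/\ forall i, subspace (S i),
      forall v : M, exists (s : seq I) (x : I -> M),
        (forall i, i \in s -> S i (x i)) /\ v = \sum_(i <- s) x i
    & forall (s : seq I) (x : I -> M), uniq s ->
        (forall i, i \in s -> S i (x i)) -> \sum_(i <- s) x i = 0 ->
        forall i, i \in s -> x i = 0].

(* Generalised binomial coefficient 'C(m, j) for m in Z. *)
Definition binz (F : fieldType) (m : int) (j : nat) : F :=
  (\prod_(i < j) (m%:~R - i%:R)) / (j`!)%:R.

(* Equality of two series of vectors with finitely many nonzero terms. *)
Definition eq_finsums (F : fieldType) (M : lmodType F) (f g : nat -> M) : Prop :=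
  exists N0 : nat, forall N : nat, (N0 <= N)%N ->
    \sum_(j < N) f j = \sum_(j < N) g j.

(* nprod a n b is the n-th product a_(n) b, the coefficient of z^(-n-1) in
   Y(a,z)b; equivalently, a(z)b(w) ~ sum over n >= 0 of
   (a_(n) b)(w) / (z-w)^(n+1).  All vectors are even. *)
Record vertexAlg (F : fieldType) := VertexAlg {
  va_car :> lmodType F;
  vac : va_car;
  nprod : va_car -> int -> va_car -> va_car;
  nprod_linear_r : forall a n, linear (nprod a n);
  nprod_linear_l : forall n b, linear (fun a => nprod a n b);
  nprod_trunc : forall a b, exists N : nat, forall n : nat, (N <= n)%N ->
    nprod a n%:Z b = 0;
  nprod_vac : forall n b, nprod vac n b = if n == -1 then b else 0;
  nprod_creation : forall a, nprod a (-1) vac = a;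
  nprod_creation0 : forall a (n : nat), nprod a n%:Z vac = 0;
  nprod_borcherds : forall (a b c : va_car) (l m n : int),
    eq_finsums
      (fun j => binz F m j *: nprod (nprod a (l + j%:Z) b) (m + n - j%:Z) c)
      (fun j => ((-1) ^+ j * binz F l j) *:
         (nprod a (m + l - j%:Z) (nprod b (n + j%:Z) c)
          - (-1) ^ l *: nprod b (n + l - j%:Z) (nprod a (m + j%:Z) c)))
}.

Definition transl (F : fieldType) (V : vertexAlg F) (a : V) : V :=
  nprod a (-2) (vac V).

Definition va_hom (F : fieldType) (V W : vertexAlg F) (f : {linear V -> W}) : Prop :=
  f (vac V) = vac W /\ forall a n b, f (nprod a n b) = nprod (f a) n (f b).

Definition va_ideal (F : fieldType) (V : vertexAlg F) (I : set V) : Prop :=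
  subspace I /\
  forall a n b, I b -> I (nprod a n b) /\ I (nprod b n a).

Definition va_simple (F : fieldType) (V : vertexAlg F) : Prop :=
  vac V <> 0 /\
  forall I : set V, va_ideal I -> I `<=` [set 0] \/ I = setT.

(* The Virasoro modes of omega are L_n = omega_(n+1). *)
Definition homog (F : fieldType) (V : vertexAlg F) (omega : V) (d : int) : set V :=
  [set a | nprod omega 1 a = d%:~R *: a].

Definition conformal_vector (F : fieldType) (V : vertexAlg F) (omega : V) (c : F) :
    Prop :=
  [/\ nprod omega 3 omega = (c / 2) *: vac V,
      nprod omega 2 omega = 0,
      nprod omega 1 omega = 2 *: omega,
      nprod omega 0 omega = transl omega
    & forall n : nat, (4 <= n)%N -> nprod omega n%:Z omega = 0] /\
  [/\ forall a, nprod omega 0 a = transl a,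
      internal_dsum (homog omega),
      forall d, fin_dim (homog omega d)
    & exists d0 : int, forall d, d < d0 -> homog omega d `<=` [set 0]].

Record vmodule (F : fieldType) (V : vertexAlg F) := VModule {
  vm_car :> lmodType F;
  vmact : V -> int -> vm_car -> vm_car;
  vmact_linear_r : forall a n, linear (vmact a n);
  vmact_linear_l : forall n w, linear (fun a => vmact a n w);
  vmact_trunc : forall a w, exists N : nat, forall n : nat, (N <= n)%N ->
    vmact a n%:Z w = 0;
  vmact_vac : forall n w, vmact (vac V) n w = if n == -1 then w else 0;
  vmact_borcherds : forall (a b : V) (w : vm_car) (l m n : int),
    eq_finsums
      (fun j => binz F m j *: vmact (nprod a (l + j%:Z) b) (m + n - j%:Z) w)
      (fun j => ((-1) ^+ j * binz F l j) *:
         (vmact a (m + l - j%:Z) (vmact b (n + j%:Z) w)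
          - (-1) ^ l *: vmact b (n + l - j%:Z) (vmact a (m + j%:Z) w)))
}.

Definition vm_submodule (F : fieldType) (V : vertexAlg F) (M : vmodule V) (S : set M) :
    Prop :=
  subspace S /\ forall a n w, S w -> S (vmact a n w).

Definition irreducible_sub (F : fieldType) (V : vertexAlg F) (M : vmodule V)
    (S : set M) : Prop :=
  [/\ vm_submodule S, exists2 w, S w & w <> 0
    & forall T : set M, vm_submodule T -> T `<=` S -> T `<=` [set 0] \/ T = S].

Definition irreducible_mod (F : fieldType) (V : vertexAlg F) (M : vmodule V) : Prop :=
  irreducible_sub (M := M) setT.

Definition mod_hom (F : fieldType) (V : vertexAlg F) (M N : vmodule V)
    (f : {linear M -> N}) : Prop :=
  forall a n w, f (vmact a n w) = vmact a n (f w).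

Definition mod_iso (F : fieldType) (V : vertexAlg F) (M N : vmodule V) : Prop :=
  exists f : {linear M -> N}, mod_hom f /\ bijective f.

(* M is isomorphic to the direct sum over i of mult i copies of H i: the map
   (x_(i,j)) |-> sum of iota_(i,j) (x_(i,j)) is a linear bijection. *)
Definition iso_dsum (F : fieldType) (V : vertexAlg F) (M : vmodule V)
    (I : finType) (H : I -> vmodule V) (mult : I -> nat) : Prop :=
  exists iota : forall i, 'I_(mult i) -> {linear H i -> M},
    (forall i j, mod_hom (iota i j)) /\
    forall w : M,
      (exists x : forall i, 'I_(mult i) -> H i,
         w = \sum_i \sum_(j < mult i) iota i j (x i j)) /\
      (forall x y : forall i, 'I_(mult i) -> H i,
         w = \sum_i \sum_(j < mult i) iota i j (x i j) ->
         w = \sum_i \sum_(j < mult i) iota i j (y i j) ->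
         forall i j, x i j = y i j).

Definition L0_eigenspace (F : fieldType) (V : vertexAlg F) (omega : V)
    (M : vmodule V) (h : F) : set M :=
  [set w | vmact omega 1 w = h *: w].

(* Ordinary module: L_0 is diagonalisable with finite-dimensional eigenspaces
   and each coset h + Z of eigenvalues is bounded below. *)
Definition vm_ordinary (F : fieldType) (V : vertexAlg F) (omega : V) (M : vmodule V) :
    Prop :=
  [/\ internal_dsum (L0_eigenspace omega (M := M)),
      forall h, fin_dim (L0_eigenspace omega (M := M) h)
    & forall h : F, exists N : nat, forall n : nat, (N <= n)%N ->
        L0_eigenspace omega (M := M) (h - n%:R) `<=` [set 0]].

(* The existence of an N-grading is encoded as a Z-grading vanishing in negative
   degrees. *)
Definition vm_admissible (F : fieldType) (V : vertexAlg F) (omega : V) (M : vmodule V) :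
    Prop :=
  exists gr : int -> set M,
    [/\ internal_dsum gr,
        forall d : int, d < 0 -> gr d `<=` [set 0]
      & forall (a : V) (e : int) (n d : int) (w : M), homog omega e a -> gr d w ->
          gr (d + e - n - 1) (vmact a n w)].

Definition va_rational (F : fieldType) (V : vertexAlg F) (omega : V) : Prop :=
  forall M : vmodule V, vm_admissible omega M ->
    exists (I : choiceType) (S : I -> set M),
      (forall i, irreducible_sub (S i)) /\ internal_dsum S.

Definition C2_cofinite (F : fieldType) (V : vertexAlg F) : Prop :=
  exists s : seq V,
    lin_span ([set x | x \in s] `|` [set nprod a (-2) b | a in setT & b in setT])
    = setT.

(* Y x w1 w2 is the coefficient of z^(-x-1) in Y(w1,z)w2.  The exponents are
   arbitrary elements of the base field; no logarithms of z are needed since L_0 is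
   diagonalisable on all the modules considered. *)
Definition intertwining (F : fieldType) (V : vertexAlg F) (omega : V)
    (M1 M2 M3 : vmodule V) (Y : F -> M1 -> M2 -> M3) : Prop :=
  [/\ forall x w1, linear (Y x w1),
      forall x w2, linear (fun w1 => Y x w1 w2),
      forall x w1 w2, exists N : nat, forall n : nat, (N <= n)%N ->
        Y (x + n%:R) w1 w2 = 0,
      forall x w1 w2, Y x (vmact omega 0 w1) w2 = - x *: Y (x - 1) w1 w2
    & forall (a : V) (w1 : M1) (w2 : M2) (l m : int) (x : F),
        eq_finsums
          (fun j => binz F m j *: Y (m%:~R + x - j%:R) (vmact a (l + j%:Z) w1) w2)
          (fun j => ((-1) ^+ j * binz F l j) *:
             (vmact a (m + l - j%:Z) (Y (x + j%:R) w1 w2)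
              - (-1) ^ l *: Y (x + l%:~R - j%:R) w1 (vmact a (m + j%:Z) w2)))].

(* The space of intertwining operators of type (M3 ; M1 M2) has dimension d. *)
Definition dim_intertwining (F : fieldType) (V : vertexAlg F) (omega : V)
    (M1 M2 M3 : vmodule V) (d : nat) : Prop :=
  exists B : 'I_d -> F -> M1 -> M2 -> M3,
    (forall i, intertwining omega (B i)) /\
    forall Y : F -> M1 -> M2 -> M3, intertwining omega Y ->
      exists! c : {ffun 'I_d -> F},
        forall x w1 w2, Y x w1 w2 = \sum_i c i *: B i x w1 w2.

Definition fusion_product (F : fieldType) (V : vertexAlg F) (omega : V)
    (M1 M2 P : vmodule V) (Y : F -> M1 -> M2 -> P) : Prop :=
  [/\ vm_ordinary omega P, intertwining omega Y
    & forall (W : vmodule V) (X : F -> M1 -> M2 -> W),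
        vm_ordinary omega W -> intertwining omega X ->
        exists f : {linear P -> W},
          [/\ mod_hom f, forall x w1 w2, X x w1 w2 = f (Y x w1 w2)
            & forall g : {linear P -> W}, mod_hom g ->
                (forall x w1 w2, X x w1 w2 = g (Y x w1 w2)) -> g =1 f]].

Definition bp_ope (F : fieldType) (k : F) (V : vertexAlg F) (J L Gp Gm : V) : Prop :=
  let kJ := (2 * k + 3) / 3 in
  [/\ [/\ nprod J 1 J = kJ *: vac V, nprod J 0 J = 0
        & forall n : nat, (2 <= n)%N -> nprod J n%:Z J = 0],
      [/\ nprod J 0 Gp = Gp, nprod J 0 Gm = - Gm
        & forall n : nat, (1 <= n)%N ->
            nprod J n%:Z Gp = 0 /\ nprod J n%:Z Gm = 0],
      forall n : nat, nprod Gp n%:Z Gp = 0 /\ nprod Gm n%:Z Gm = 0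
    & [/\ nprod Gp 2 Gm = ((k + 1) * (2 * k + 3)) *: vac V,
          nprod Gp 1 Gm = (3 * (k + 1)) *: J,
          nprod Gp 0 Gm = 3 *: nprod J (-1) J + k *: transl J - (k + 3) *: L
        & forall n : nat, (3 <= n)%N -> nprod Gp n%:Z Gm = 0]] /\
  [/\ [/\ nprod L 2 J = kJ *: vac V, nprod L 1 J = J, nprod L 0 J = transl J
        & forall n : nat, (3 <= n)%N -> nprod L n%:Z J = 0],
      [/\ nprod L 1 Gp = 2 *: Gp, nprod L 0 Gp = transl Gp
        & forall n : nat, (2 <= n)%N -> nprod L n%:Z Gp = 0],
      [/\ nprod L 1 Gm = Gm, nprod L 0 Gm = transl Gm
        & forall n : nat, (2 <= n)%N -> nprod L n%:Z Gm = 0]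
    & conformal_vector L (- (4 * (k + 1) * (2 * k + 3)) / (k + 3))].

(* The pair (i, n) stands for the creation mode (g i)_(-n-1). *)
Definition pbw_le (r : nat) (p q : 'I_r * nat) : bool :=
  (p.1 < q.1)%N || ((p.1 == q.1) && (q.2 <= p.2)%N).

Definition pbw_mono (F : fieldType) (V : vertexAlg F) (r : nat) (g : 'I_r -> V)
    (s : seq ('I_r * nat)) : V :=
  foldr (fun p v => nprod (g p.1) (- (p.2.+1)%:Z) v) (vac V) s.

(* The ordered monomials in the creation modes of the generators g, applied to the
   vacuum, form a basis of V. *)
Definition freely_strongly_generated (F : fieldType) (V : vertexAlg F) (r : nat)
    (g : 'I_r -> V) : Prop :=
  lin_span [set pbw_mono g s | s in [set s | sorted (@pbw_le r) s]] = setT /\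
  forall (t : seq (seq ('I_r * nat))) (c : seq ('I_r * nat) -> F),
    uniq t -> all (sorted (@pbw_le r)) t ->
    \sum_(s <- t) c s *: pbw_mono g s = 0 -> forall s, s \in t -> c s = 0.

(* V is (a model of) the universal Bershadsky-Polyakov algebra BP^k. *)
Definition is_universal_BP (F : fieldType) (k : F) (V : vertexAlg F)
    (J L Gp Gm : V) : Prop :=
  bp_ope k J L Gp Gm /\
  freely_strongly_generated (tnth [tuple J; L; Gp; Gm]).

Definition is_simple_BP (F : fieldType) (k : F) (V : vertexAlg F)
    (J L Gp Gm : V) : Prop :=
  va_simple V /\
  exists (V0 : vertexAlg F) (J0 L0 Gp0 Gm0 : V0) (pi : {linear V0 -> V}),
    [/\ is_universal_BP k J0 L0 Gp0 Gm0, va_hom pi, range pi = setT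
      & [/\ pi J0 = J, pi L0 = L, pi Gp0 = Gp & pi Gm0 = Gm]].

(* With the conformal weights 1, 2, 2, 1 of J, L, Gp, Gm, the modes are
   J_n = J_(n), L_n = L_(n+1), Gp_n = Gp_(n+1) and Gm_n = Gm_(n). *)
Definition is_hw_module (F : fieldType) (V : vertexAlg F) (J L Gp Gm : V)
    (M : vmodule V) (j h : F) : Prop :=
  exists v : M,
    [/\ forall n : nat, (0 < n)%N ->
          [/\ vmact J n%:Z v = 0, vmact L (n%:Z + 1) v = 0,
              vmact Gp (n%:Z + 1) v = 0 & vmact Gm n%:Z v = 0],
        vmact Gp 1 v = 0,
        vmact J 0 v = j *: v,
        vmact L 1 v = h *: v
      & forall S : set M, vm_submodule S -> S v -> S = setT].

(* Dynkin labels (l0, l1, l2) of level l; each label is automatically at most l. *)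
Definition Pge (l : nat) : finType :=
  {f : {ffun 'I_3 -> 'I_l.+1} | (\sum_(i < 3) f i == l)%N}.

Definition label1 (l : nat) (la : Pge l) : nat := val la (@Ordinal 3 1 isT).

Definition label2 (l : nat) (la : Pge l) : nat := val la (@Ordinal 3 2 isT).

Fact Pge_vac_subproof (l : nat) :
  (\sum_(i < 3) [ffun j : 'I_3 => if j == ord0 then ord_max else ord0 : 'I_l.+1] i == l)%N.
Proof. by rewrite !big_ord_recl big_ord0 !ffunE /= !addn0. Qed.

Definition Pge_vac (l : nat) : Pge l :=
  exist _ [ffun j : 'I_3 => if j == ord0 then ord_max else ord0 : 'I_l.+1]
    (Pge_vac_subproof l).

(* The dual h^* of the Cartan subalgebra of sl_3 is realised as the traceless
   vectors of R^3, with roots e_i - e_j, the standard inner product and the Weyl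
   group S_3 permuting the coordinates. *)
Definition omega1 (R : realType) : 'rV[R]_3 :=
  \row_i (if i == ord0 then 2 / 3 else - (1 / 3)).

Definition omega2 (R : realType) : 'rV[R]_3 :=
  \row_i (if i == ord_max then - (2 / 3) else 1 / 3).

Definition plus_rho (R : realType) (l : nat) (la : Pge l) : 'rV[R]_3 :=
  (label1 la).+1%:R *: omega1 R + (label2 la).+1%:R *: omega2 R.

Definition weyl (R : realType) (w : 'S_3) (x : 'rV[R]_3) : 'rV[R]_3 :=
  \row_i x 0 ((w^-1)%g i).

Definition pairing (R : realType) (x y : 'rV[R]_3) : R :=
  \sum_(i < 3) x 0 i * y 0 i.

(* exp (i t) *)
Definition expi (R : realType) (t : R) : R[i] := (cos t +i* sin t)%C.

(* Sum over w in S_3 of det(w) exp (- a i <w(la + rho), la' + rho>). *)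
Definition weyl_sum (R : realType) (l : nat) (a : R) (la la' : Pge l) : R[i] :=
  \sum_(w : 'S_3) (-1) ^+ (odd_perm w) *
    expi (- a * pairing (weyl w (plus_rho R la)) (plus_rho R la')).

Definition S_A2 (R : realType) (u : nat) (la la' : Pge (u - 3)) : R[i] :=
  - 'i%C / (Num.sqrt 3 * u%:R)%:C%C * weyl_sum (2 * pi / u%:R) la la'.

Definition jwt (F : fieldType) (l : nat) (la : Pge l) : F :=
  - (((label1 la)%:R - (label2 la)%:R) / 3).

Definition hwt (F : fieldType) (u l : nat) (la : Pge l) : F :=
  let l1 : F := (label1 la)%:R in
  let l2 : F := (label2 la)%:R in
  ((l1 - l2) * (l1 - l2 - u%:R) + 3 * (l1 + l2) * (l1 + l2 - u%:R + 4))
    / (6 * u%:R).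

Definition S_BP (R : realType) (u : nat) (la la' : Pge (u - 3)) : R[i] :=
  'i%C / (Num.sqrt 3 * u%:R)%:C%C
  * expi (2 * pi * (jwt R la + jwt R la' - u%:R / 3))
  * weyl_sum (4 * pi / u%:R) la la'.

Definition verlinde (R : realType) (l : nat) (S : Pge l -> Pge l -> R[i])
    (la mu nu : Pge l) : R[i] :=
  \sum_(La : Pge l) S la La * S mu La * (S nu La)^*%C / S (Pge_vac l) La.

(* Main.v *)
(* Verlinde sums.  Up to phases, S^BP(la, La) is the A_2 matrix entry with la + rho
   paired with 2 (La + rho).  The summand of the A_2 Verlinde formula extends to a
   function f on the weight lattice that is invariant under the Weyl group, vanishes on
   the walls of the alcove (where the junk value x / 0 = 0 is harmless) and is multiplied
   by a power of a cube root of unity chi under translation by u times a fundamental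
   weight.  If chi <> 1, the rotation of the alcove shows that both sums vanish.  If
   chi = 1, twice the sum over the alcove is the sum of f over (Z/u)^2, which doubling
   permutes because u is odd, and the phases of S^BP cancel.

   Fusion products.  An ordinary module is admissible, hence by rationality a direct sum
   of irreducible ones, and the sum is finite because the L_0-eigenspaces are
   finite-dimensional.  Together with Schur's lemma this makes the sum over nu of
   N(la, mu, nu) copies of H_nu, with the tuple of all basis intertwining operators,
   universal.  Schur's lemma is applied to pairwise non-isomorphic H_nu: since
   N(la, 0, nu) is the inner product of rows la and nu of S^BP, isomorphic modules have
   equal rows, and the ratio of the entries at omega_1 and 0 recovers the weight. *)
Require Import Defs.
From HB Require Import structures.
From mathcomp Require Import all_boot all_order all_fingroup all_algebra.
From mathcomp Require Import all_classical all_reals all_analysis complex.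
From mathcomp Require Import zify ring lra.

Set Implicit Arguments.
Unset Strict Implicit.
Unset Printing Implicit Defensive.

Import Order.TTheory GRing.Theory Num.Theory.
Local Open Scope ring_scope.

(* mathcomp-analysis has a topological [subspace], which hides the linear one. *)
Local Notation vsubspace := Defs.subspace.

(** * Internal direct sums *)

Section InternalDirectSum.
Variables (F : fieldType) (M : lmodType F).

Lemma subspaceZ (S : set M) c x : vsubspace S -> S x -> S (c *: x).
Proof. by move=> [S0 SD] Sx; rewrite -[_ *: _]addr0; apply: SD. Qed.

Lemma subspaceD (S : set M) x y : vsubspace S -> S x -> S y -> S (x + y).
Proof. by move=> [S0 SD] Sx Sy; rewrite -[x]scale1r; apply: SD. Qed.

Lemma subspaceB (S : set M) x y : vsubspace S -> S x -> S y -> S (x - y).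
Proof.
by move=> hS Sx Sy; rewrite -scaleN1r; apply: subspaceD => //; apply: subspaceZ.
Qed.

Lemma big_supp_sub (I : eqType) (s t : seq I) (f : I -> M) :
  uniq s -> uniq t -> {subset s <= t} -> (forall i, i \notin s -> f i = 0) ->
  \sum_(i <- s) f i = \sum_(i <- t) f i.
Proof.
move=> us ut st f0; rewrite [RHS](bigID (mem s)) /= [X in _ + X]big1 // addr0.
rewrite -[RHS]big_filter; apply: perm_big; apply: uniq_perm => //.
  by rewrite filter_uniq.
by move=> i; rewrite mem_filter /=; case: (boolP (i \in s)) => //= /st ->.
Qed.

Variables (I : choiceType) (S : I -> set M).
Hypothesis dS : internal_dsum S.

Let subS i : vsubspace (S i). Proof. by case: dS. Qed.

(** In [internal_dsum] the list may repeat indices and the family is arbitrary off the list. A total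
    family vanishing off a finite set makes the components of [v] unique as a function. *)
Definition finsupp_family (v : M) (f : I -> M) : Prop :=
  (forall i, S i (f i)) /\
  exists s, [/\ uniq s, forall i, i \notin s -> f i = 0 & v = \sum_(i <- s) f i].

Lemma finsupp_family_exists v : exists f, finsupp_family v f.
Proof.
case: dS => _ /(_ v) [s [x [Sx ->]]] _.
(* An index occurring several times in [s] contributes its vector once per occurrence. *)
exists (fun i => if i \in s then x i *+ count_mem i s else 0); split=> [i|].
  case: ifP => [/Sx Sxi|_]; last by case: (subS i).
  by rewrite -scaler_nat; apply: subspaceZ.
exists (undup s); split; first exact: undup_uniq.
  by move=> i; rewrite mem_undup => /negbTE ->.
rewrite -[LHS]big_undup_iterop_count big_seq [RHS]big_seq.
apply: eq_bigr => i; rewrite mem_undup => ->.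
by elim: (count_mem i s) => // n IH; rewrite !iteropS /= mulrS; congr (_ + _);
   elim: n {IH} => // n IH; rewrite iterS IH mulrS.
Qed.

Lemma finsupp_family_unique v f g :
  finsupp_family v f -> finsupp_family v g -> f = g.
Proof.
move=> [Sf [s [us f0 vf]]] [Sg [t [ut g0 vg]]]; apply/funext => i.
pose r := undup (s ++ t).
have ur : uniq r by exact: undup_uniq.
have sr : {subset s <= r} by move=> j js; rewrite mem_undup mem_cat js.
have tr : {subset t <= r} by move=> j js; rewrite mem_undup mem_cat js orbT.
have [_ _ /(_ r (fun i => f i - g i) ur)] := dS => H.
have {}H : forall i, i \in r -> f i - g i = 0.
  apply: H => [j _|]; first exact: subspaceB.
  by rewrite sumrB -(big_supp_sub us ur sr f0) -(big_supp_sub ut ur tr g0)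
     -vf -vg subrr.
case: (boolP (i \in r)) => [/H/eqP|]; first by rewrite subr_eq0 => /eqP.
by rewrite mem_undup mem_cat negb_or => /andP[/f0 -> /g0 ->].
Qed.

Definition dsum_proj (i : I) (v : M) : M := sval (cid (finsupp_family_exists v)) i.

Lemma dsum_projP v : finsupp_family v (dsum_proj^~ v).
Proof. exact: svalP (cid (finsupp_family_exists v)). Qed.

Lemma dsum_proj_in i v : S i (dsum_proj i v).
Proof. by case: (dsum_projP v) => /(_ i). Qed.

Lemma dsum_proj_eq v f : finsupp_family v f -> dsum_proj^~ v = f.
Proof. exact: finsupp_family_unique (dsum_projP v). Qed.

Lemma dsum_proj_supp v : exists s, [/\ uniq s,
  forall i, i \notin s -> dsum_proj i v = 0 & v = \sum_(i <- s) dsum_proj i v].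
Proof. by case: (dsum_projP v). Qed.

Lemma dsum_proj_linear i : linear (dsum_proj i).
Proof.
move=> c v w; have [[Sv [s [us v0 vE]]] [Sw [t [ut w0 wE]]]] :=
  (dsum_projP v, dsum_projP w).
suff : finsupp_family (c *: v + w) (fun i => c *: dsum_proj i v + dsum_proj i w).
  by move=> /dsum_proj_eq /(congr1 (fun f => f i)).
split=> [j|]; first by apply: subspaceD => //; apply: subspaceZ.
exists (undup (s ++ t)); split; first exact: undup_uniq.
  move=> j; rewrite mem_undup mem_cat negb_or => /andP[/v0 -> /w0 ->].
  by rewrite scaler0 addr0.
rewrite big_split /= -scaler_sumr {1}vE {1}wE; congr (c *: _ + _).
  by apply: big_supp_sub; rewrite ?undup_uniq // => j js;
     rewrite mem_undup mem_cat js.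
by apply: big_supp_sub; rewrite ?undup_uniq // => j js;
   rewrite mem_undup mem_cat js orbT.
Qed.

HB.instance Definition _ i :=
  GRing.isLinear.Build F M M *:%R (dsum_proj i) (dsum_proj_linear i).

Lemma dsum_proj_id i v : S i v -> dsum_proj i v = v.
Proof.
move=> Sv; suff : finsupp_family v (fun j => if j == i then v else 0).
  by move=> /dsum_proj_eq /(congr1 (fun f => f i)); rewrite eqxx.
split=> [j|]; first by case: eqP => [->//|_]; case: (subS j).
exists [:: i]; split=> // [j|]; last by rewrite big_seq1 eqxx.
by rewrite inE => /negbTE ->.
Qed.

Lemma dsum_proj_neq i j v : i != j -> S i v -> dsum_proj j v = 0.
Proof.
move=> nij Sv; suff : finsupp_family v (fun j => if j == i then v else 0).
  by move=> /dsum_proj_eq /(congr1 (fun f => f j)); rewrite eq_sym (negbTE nij).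
split=> [k|]; first by case: eqP => [->//|_]; case: (subS k).
exists [:: i]; split=> // [k|]; last by rewrite big_seq1 eqxx.
by rewrite inE => /negbTE ->.
Qed.

Lemma dsum_proj_comm (T : {linear M -> M}) i v :
  (forall j x, S j x -> S j (T x)) -> dsum_proj i (T v) = T (dsum_proj i v).
Proof.
move=> ST; have [Sv [s [us v0 vE]]] := dsum_projP v.
suff : finsupp_family (T v) (fun j => T (dsum_proj j v)).
  by move=> /dsum_proj_eq /(congr1 (fun f => f i)).
split=> [j|]; first exact: ST.
exists s; split=> // [j /v0 ->|]; first by rewrite linear0.
by rewrite {1}vE linear_sum.
Qed.

(** Grouping summands by [deg] turns the decomposition by L_0-eigenvalues into a Z-grading. A group
    is described by the vanishing of all other projections. *)
Lemma internal_dsum_coarsen (J : choiceType) (deg : I -> J) :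
  internal_dsum (fun j => [set v | forall i, deg i != j -> dsum_proj i v = 0]%classic).
Proof.
split=> [j|v|s x us Sx x0 j js].
- split=> [i _|c x y hx hy i ij] /=; first by rewrite linear0.
  by rewrite dsum_proj_linear hx // hy // scaler0 addr0.
- have [s [us v0 vE]] := dsum_proj_supp v.
  exists (undup (map deg s)), (fun j => \sum_(i <- s | deg i == j) dsum_proj i v).
  split=> [j _ /= i ij|].
    rewrite linear_sum big1 //= => k /eqP kj; rewrite (dsum_proj_neq (i := k) (j := i)) //.
      by apply: contra_neq ij => <-.
    exact: dsum_proj_in.
  rewrite {1}vE (exchange_big_dep xpredT) //= big_seq [RHS]big_seq.
  apply: eq_bigr => i is_; rewrite -big_filter.
  rewrite (_ : [seq _ <- _ | _] = [:: deg i]) ?big_seq1 //.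
  apply/perm_small_eq => //; apply: uniq_perm => //.
    by rewrite filter_uniq ?undup_uniq.
  move=> j; rewrite mem_filter mem_undup mem_seq1 [j == _]eq_sym.
  by apply/andP/eqP => [[/eqP]//|<-]; split; [apply/eqP|apply: map_f].
- have [t [ut t0 tE]] := dsum_proj_supp (x j).
  rewrite tE big1_seq // => i /andP[_ it].
  have [dij|dij] := eqVneq (deg i) j; last exact: Sx.
  have := congr1 (dsum_proj i) x0; rewrite linear_sum linear0.
  rewrite (bigD1_seq j) //= big1_seq ?addr0 // => k /andP[kj ks].
  by apply: (Sx k ks); rewrite dij eq_sym.
Qed.

End InternalDirectSum.

(** * Modules over a vertex algebra *)

HB.instance Definition _ (F : fieldType) (V : vertexAlg F) (M : vmodule V) a n :=
  GRing.isLinear.Build F M M *:%R (@vmact F V M a n) (vmact_linear_r (v := M) a n).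

Section ConformalWeight.
Variable F : numFieldType.

(** The Borcherds identity only equates long partial sums; once both supports are bounded, each side
    can be cut at its own bound. *)
Lemma eq_finsums_trunc (M : lmodType F) (f g : nat -> M) (a b : nat) :
  eq_finsums f g -> (forall j, (a <= j)%N -> f j = 0) ->
  (forall j, (b <= j)%N -> g j = 0) -> \sum_(j < a) f j = \sum_(j < b) g j.
Proof.
have trunc (h : nat -> M) c n : (c <= n)%N -> (forall j, (c <= j)%N -> h j = 0) ->
    \sum_(j < n) h j = \sum_(j < c) h j.
  move=> cn h0; rewrite -!(big_mkord xpredT) (big_cat_nat _ (n := c)) //=.
  by rewrite [X in _ + X]big_nat_cond [X in _ + X]big1 ?addr0 // => i /andP[/andP[/h0]].
move=> [N0 H] fa gb; have := H (N0 + a + b)%N; rewrite -addnA leq_addr => /(_ isT).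
by rewrite (trunc f a) ?(trunc g b) //; lia.
Qed.

Lemma binz0 m : binz F m 0 = 1.
Proof. by rewrite /binz big_ord0 fact0 divr1. Qed.

Lemma binz_zero j : (0 < j)%N -> binz F 0 j = 0.
Proof.
by case: j => // j _; rewrite /binz big_ord_recl /= subrr mul0r mul0r.
Qed.

Lemma binz_one1 : binz F 1 1 = 1.
Proof. by rewrite /binz big_ord1 subr0 mulr1z divr1. Qed.

Lemma binz_one j : (1 < j)%N -> binz F 1 j = 0.
Proof.
by case: j => [|[|j]] // _; rewrite /binz 2!big_ord_recl /= subrr mul0r mulr0 mul0r.
Qed.

Lemma binz_opp2 j : (-1) ^+ j * binz F (-2) j = j.+1%:R.
Proof.
have f0 n : (n`!)%:R != 0 :> F by rewrite pnatr_eq0 -lt0n fact_gt0.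
rewrite /binz mulrA; apply: (mulIf (f0 j)); rewrite divfK // -natrM.
rewrite -[(j.+1 * _)%N]/(j.+1`!).
elim: j => [|j IH]; first by rewrite big_ord0 expr0 mulr1.
rewrite big_ord_recr /= factS natrM -IH exprS -[j.+2%:R]natr1 -[j.+1%:R]natr1 rmorphN /=.
by ring.
Qed.

Variables (V : vertexAlg F) (M : vmodule V).

Lemma vmact0r a n : vmact a n (0 : M) = 0.
Proof. exact: linear0. Qed.

Lemma vmact0l n (w : M) : vmact (0 : V) n w = 0.
Proof.
have := vmact_linear_l n w 1 (0 : V) 0.
by rewrite !scale1r addr0 => /eqP; rewrite -subr_eq subrr eq_sym => /eqP.
Qed.

Lemma vmactZr c a n (w : M) : vmact a n (c *: w) = c *: vmact a n w.
Proof. exact: linearZ. Qed.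

Lemma vmactZl c (a : V) n (w : M) : vmact (c *: a) n w = c *: vmact a n w.
Proof. by rewrite -[c *: a]addr0 vmact_linear_l vmact0l addr0. Qed.

(** This is the Borcherds identity with l = -2, m = 0 and b the vacuum: on the left only j = 0
    survives, on the right only the terms in which the vacuum mode has index -1. *)
Lemma vmact_transl (a : V) n (w : M) :
  vmact (transl a) n w = - n%:~R *: vmact a (n - 1) w.
Proof.
have /= B := vmact_borcherds a (vac V) w (-2) 0 n.
pose c := `|n|%N.+1.
have {B} := eq_finsums_trunc (a := 1) (b := c) B.
rewrite big_ord1 binz0 scale1r addr0 add0r subr0 => ->; first last.
- move=> j hj; rewrite !vmact_vac.
  have -> : (n + j%:Z == -1) = false by lia.
  have -> : (n + -2 - j%:Z == -1) = false by lia.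
  by rewrite vmact0r scaler0 subrr scaler0.
- by move=> j /binz_zero ->; rewrite scale0r.
have E (j : nat) : ((-1) ^+ j * binz F (-2) j) *:
    (vmact a (0 + -2 - j%:Z) (vmact (vac V) (n + j%:Z) w)
       - (-1) ^ (-2) *: vmact (vac V) (n + -2 - j%:Z) (vmact a (0 + j%:Z) w)) =
    (if n + j%:Z == -1 then - n%:~R else 0) *: vmact a (n - 1) w
    + (if n - j%:Z == 1 then - n%:~R else 0) *: vmact a (n - 1) w.
  rewrite binz_opp2 !vmact_vac.
  have -> : (n + -2 - j%:Z == -1) = (n - j%:Z == 1) by lia.
  have -> : (-1) ^ (-2) = 1 :> F by rewrite -exprnN expr2 mulrNN mulr1 invr1.
  rewrite scale1r scalerBr; congr (_ + _).
    case: eqP => [nj|_]; last by rewrite vmact0r scaler0 scale0r.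
    have -> : 0 + -2 - j%:Z = n - 1 by lia.
    have -> : n = - (j.+1)%:Z by lia.
    by rewrite rmorphN /= opprK.
  case: eqP => [nj|_]; last by rewrite scaler0 oppr0 scale0r.
  have -> : 0 + j%:Z = n - 1 by lia.
  have -> : n = (j.+1)%:Z by lia.
  by rewrite scaleNr.
under eq_bigr do rewrite E.
rewrite big_split /= -!scaler_suml -scalerDl.
congr (_ *: _).
have S1 (P : nat -> bool) (k : 'I_c) : (forall j : nat, P j = (j == k)) ->
    \sum_(j < c) (if P j then - n%:~R else 0) = - n%:~R :> F.
  move=> hP; rewrite (bigD1 k) //= hP eqxx big1 ?addr0 // => j /negbTE jk.
  by rewrite hP; move: jk; rewrite -val_eqE => ->.
have S0 (P : nat -> bool) : (forall j : nat, P j = false) ->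
    \sum_(j < c) (if P j then - n%:~R else 0) = 0 :> F.
  by move=> hP; rewrite big1 // => j _; rewrite hP.
(* For n < 0 only the first condition is ever met, at j = -n-1; for n > 0 only the second, at j =
   n-1; for n = 0 neither, in agreement with the factor -n. *)
pose P1 (j : nat) := n + j%:Z == -1; pose P2 (j : nat) := n - j%:Z == 1.
case: (ltrgtP n 0) => n0.
- have hk : (`|n|.-1 < c)%N by rewrite /c; lia.
  rewrite (S1 P1 (Ordinal hk)) ?(S0 P2) ?addr0 //= /P1 /P2 => j; lia.
- have hk : (`|n|.-1 < c)%N by rewrite /c; lia.
  rewrite (S0 P1) ?(S1 P2 (Ordinal hk)) ?add0r //= /P1 /P2 => j; lia.
by rewrite (S0 P1) ?(S0 P2) ?addr0 ?n0 ?mulr0z ?oppr0 // /P1 /P2 => j; lia.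
Qed.

Variables (omega : V).
Hypothesis transl_omega : forall a : V, nprod omega 0 a = transl a.

(** The Borcherds identity with l = 0, m = 1 is the commutator formula [omega_1, a_n] = (omega_0
    a)_(n+1) + (omega_1 a)_n, and omega_0 a is the translate of a. *)
Lemma vmact_L0_comm (a : V) (n : int) (w : M) :
  vmact omega 1 (vmact a n w) =
  vmact a n (vmact omega 1 w) + vmact (nprod omega 1 a) n w
  - (n + 1)%:~R *: vmact a n w.
Proof.
have := eq_finsums_trunc (a := 2) (b := 1) (vmact_borcherds omega a w 0 1 n).
move=> /(_ (fun j hj => ltac:(by rewrite binz_one // scale0r))
            (fun j hj => ltac:(by rewrite binz_zero // mulr0 scale0r))).
rewrite big_ord1 !big_ord_recl big_ord0 /= !binz0 binz_one1 mulr1 !scale1r.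
rewrite transl_omega vmact_transl addr0 => E.
suff /eqP : - (n + 1)%:~R *: vmact a n w + vmact (nprod omega 1 a) n w =
    vmact omega 1 (vmact a n w) - vmact a n (vmact omega 1 w).
  by rewrite eq_sym subr_eq => /eqP ->; rewrite scaleNr addrC [X in _ + X]addrC addrA.
apply: etrans (etrans E _).
  rewrite [vmact _ _ _ + 0]addr0.
  by congr (- _%:~R *: vmact a _ w + vmact (nprod omega _ a) _ w); rewrite ?/bump; lia.
by congr (vmact omega _ (vmact a _ w) - vmact a _ (vmact omega _ w)); lia.
Qed.

End ConformalWeight.

(** * Ordinary modules are admissible *)

Section OrdinaryAdmissible.
Variables (F : numFieldType) (V : vertexAlg F) (omega : V).
Hypothesis transl_omega : forall a : V, nprod omega 0 a = transl a.

Lemma L0_eigenspace_vmact (M : vmodule V) a e n h (w : M) : homog omega e a ->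
  L0_eigenspace omega h w ->
  L0_eigenspace omega (h + (e - n - 1)%:~R) (vmact a n w).
Proof.
rewrite /homog /L0_eigenspace /= => ha hw.
rewrite vmact_L0_comm // hw ha vmactZr vmactZl -scaleNr -!scalerDl.
by congr (_ *: _); rewrite !rmorphD /= !rmorphN /= rmorph1; ring.
Qed.

Variable M : vmodule V.
Hypothesis ordM : vm_ordinary omega M.

(* Each coset of Z in F is bounded below by hypothesis, so a lower bound chosen in it
   serves as its zero. *)
Lemma ordinary_degree : exists deg : F -> int,
  (forall h z, deg (h + z%:~R) = deg h + z) /\
  forall h, deg h < 0 -> forall w, L0_eigenspace (M := M) omega h w -> w = 0.
Proof.
case: ordM => _ _ bdd.
pose C (h : F) : set F := [set h' | (exists z : int, h = h' + z%:~R) /\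
  forall n : nat, forall w, L0_eigenspace (M := M) omega (h' - n.+1%:R) w -> w = 0]%classic.
have C0 h : exists h', C h h'.
  have [N hN] := bdd h; exists (h - N%:R); split; first by exists N%:Z; rewrite subrK.
  move=> n w; rewrite -addrA -opprD -natrD; apply: hN; lia.
have CD h z : C (h + z%:~R) = C h.
  apply/seteqP; split=> h' [[y hy] hn]; split=> //.
    by exists (y - z); rewrite rmorphB /= addrA -hy addrK.
  by exists (y + z); rewrite rmorphD /= addrA -hy.
(* [C] is constant on cosets of Z, so the chosen representative depends on the coset only. *)
pose rep h := xget 0 (C h).
have repP h : C h (rep h) by rewrite /rep; have := @xgetPex F 0 (C h) (C0 h).
pose deg h := sval (cid (repP h).1).
have degP h : h = rep h + (deg h)%:~R by exact: svalP (cid (repP h).1).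
exists deg; split=> [h z|h].
  have := degP (h + z%:~R); have -> : rep (h + z%:~R) = rep h by rewrite /rep CD.
  rewrite [in LHS](degP h) -addrA.
  by move=> /addrI; rewrite -rmorphD /= => /intr_inj.
case E: (deg h) => [//|n] _ w hw; have [_ /(_ n w)] := repP h; apply.
by move: hw; rewrite [in X in L0_eigenspace _ X](degP h) E NegzE rmorphN.
Qed.

(** Modes of homogeneous vectors shift L_0-eigenvalues by integers, and [ordinary_degree] turns
    these into shifts of a degree that is nonnegative on nonzero eigenvectors. *)
Lemma ordinary_admissible : vm_admissible omega M.
Proof.
have [deg [degD deg0]] := ordinary_degree; case: (ordM) => dM _ _.
have := internal_dsum_coarsen dM deg; set gr := (X in internal_dsum X) => dgr.
exists gr; split=> // [d d0 v hv /=|a e n d w ha hw h' hh'].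
  have [s [_ _ ->]] := dsum_proj_supp dM v; rewrite big1 // => h _.
  have [hd|hd] := eqVneq (deg h) d; last exact: hv.
  by apply: (deg0 h); [rewrite hd|apply: (dsum_proj_in dM)].
have [s [_ _ wE]] := dsum_proj_supp dM w.
rewrite wE (linear_sum (vmact a n)) linear_sum big1 // => h _ /=.
have [hd|hd] := eqVneq (deg h) d; last by rewrite hw // linear0 linear0.
have /(L0_eigenspace_vmact n ha) := dsum_proj_in dM h w.
apply: dsum_proj_neq; apply: contra_neq hh' => <-.
by rewrite degD hd !addrA.
Qed.

End OrdinaryAdmissible.

(** * Submodules as modules in their own right *)

Section Submodule.
Variables (F : numFieldType) (V : vertexAlg F) (M : vmodule V) (S : set M).
Hypothesis hS : vm_submodule S.

(** The proof is a parameter so that the closure instance below can be inferred from the predicate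
    itself. *)
Definition submod_pred (_ : vm_submodule S) : {pred M} := fun x => `[< S x >].

Lemma submod_pred_closed : GRing.submod_closed (submod_pred hS).
Proof.
have [[S0 SD] _] := hS; split; first exact/asboolP.
by move=> c x y /asboolP Sx /asboolP Sy; apply/asboolP/SD.
Qed.

HB.instance Definition _ :=
  GRing.isSubmodClosed.Build F M (submod_pred hS) submod_pred_closed.

Record submod_car := Submod { submod_val : M; _ : submod_val \in submod_pred hS }.

HB.instance Definition _ := [isSub for submod_val].
HB.instance Definition _ := [Choice of submod_car by <:].
HB.instance Definition _ := [SubChoice_isSubLmodule of submod_car by <:].

Lemma submod_valP (x : submod_car) : S (\val x).
Proof. exact/asboolP/(valP x). Qed.

Definition submod_sub (x : M) (Sx : S x) : submod_car :=
  Submod (asboolT Sx : x \in submod_pred hS).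

Definition submod_act (a : V) (n : int) (w : submod_car) : submod_car :=
  submod_sub (hS.2 a n _ (submod_valP w)).

Lemma submod_act_linear_r a n : linear (submod_act a n).
Proof. by move=> c x y; apply: val_inj; rewrite /= !linearP. Qed.

Lemma submod_act_linear_l n w : linear (fun a => submod_act a n w).
Proof. by move=> c x y; apply: val_inj; rewrite /= vmact_linear_l. Qed.

Lemma submod_act_trunc a w : exists N : nat, forall n : nat, (N <= n)%N ->
  submod_act a n%:Z w = 0.
Proof.
by have [N hN] := vmact_trunc a (\val w); exists N => n /hN h; apply: val_inj.
Qed.

Lemma submod_act_vac n w : submod_act (vac V) n w = if n == -1 then w else 0.
Proof. by apply: val_inj; rewrite /= vmact_vac; case: ifP. Qed.

Lemma submod_act_borcherds (a b : V) (w : submod_car) (l m n : int) :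
  eq_finsums
    (fun j => binz F m j *: submod_act (nprod a (l + j%:Z) b) (m + n - j%:Z) w)
    (fun j => ((-1) ^+ j * binz F l j) *:
       (submod_act a (m + l - j%:Z) (submod_act b (n + j%:Z) w)
        - (-1) ^ l *: submod_act b (n + l - j%:Z) (submod_act a (m + j%:Z) w))).
Proof.
have [N0 H] := vmact_borcherds a b (\val w) l m n; exists N0 => N /H {}H.
by apply: val_inj; rewrite !linear_sum.
Qed.

Definition submod : vmodule V := VModule submod_act_linear_r submod_act_linear_l
  submod_act_trunc submod_act_vac submod_act_borcherds.

(** A submodule of the subtype has as image in [M] a submodule contained in [S], where
    irreducibility applies. *)
Lemma submod_irreducible : irreducible_sub S -> irreducible_mod submod.
Proof.
case=> _ [w Sw w0] irr; split.
- by split=> //; split.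
- exists (submod_sub Sw : submod) => // /(congr1 (\val : submod_car -> M)) /=.
  by move/w0.
move=> T [[T0 TD] hT] _.
have hT' : vm_submodule (fun x => exists2 y : submod_car, T y & x = \val y).
  split; [split|]; first by exists 0.
    by move=> c _ _ [x Tx ->] [y Ty ->]; exists (c *: x + y) => //; apply: TD.
  by move=> a n _ [x Tx ->]; exists (submod_act a n x) => //; apply: hT.
case: (irr _ hT') => [_ [y _ ->]|TE|TE]; first exact: submod_valP.
- left=> x Tx; apply: val_inj; apply: TE; by exists x.
right; apply/seteqP; split=> // x _; have := submod_valP x.
by rewrite -TE => -[y Ty /val_inj ->].
Qed.

End Submodule.

(** * Spans, linear dependence and linear maps *)

Section FiniteDimension.
Variables (F : fieldType) (M : lmodType F).

Lemma lin_span_seq (s : seq M) v : lin_span [set x | x \in s]%classic v ->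
  exists a : 'I_(size s) -> F, v = \sum_(j < size s) a j *: s`_j.
Proof.
move=> [n [c [x [xs ->]]]].
(* The coefficients of all [x i] found at the same position of [s] are added up. *)
exists (fun j => \sum_(i < n | index (x i) s == val j) c i).
under [RHS]eq_bigr do rewrite scaler_suml.
rewrite (exchange_big_dep xpredT) //=; apply: eq_bigr => i _.
have hi : (index (x i) s < size s)%N by rewrite index_mem; exact: xs.
rewrite (big_pred1 (Ordinal hi)) /= ?nth_index //; first exact: xs.
Qed.

(** The coefficient matrix has more rows than columns, so some nonzero row vector annihilates it
    from the left. *)
Lemma lin_span_dep (s : seq M) (m : nat) (x : 'I_m -> M) : (size s < m)%N ->
  (forall i, lin_span [set y | y \in s]%classic (x i)) ->
  exists2 a : 'I_m -> F, \sum_(i < m) a i *: x i = 0 & exists i, a i != 0.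
Proof.
move=> sm xs; pose a i := sval (cid (lin_span_seq (xs i))).
have xE i : x i = \sum_(j < size s) a i j *: s`_j by exact: svalP (cid (lin_span_seq (xs i))).
pose A : 'M[F]_(m, size s) := \matrix_(i, j) a i j.
have : kermx A != 0.
  by rewrite -mxrank_eq0 mxrank_ker subn_eq0 -ltnNge (leq_ltn_trans (rank_leq_col A)).
case/rowV0Pn => u /sub_kermxP uA u0.
exists (fun i => u 0 i).
  under eq_bigr do rewrite xE scaler_sumr.
  rewrite exchange_big big1 //= => j _; under eq_bigr do rewrite scalerA.
  rewrite -scaler_suml; have := congr1 (fun B : 'rV_(size s) => B 0 j) uA.
  by rewrite !mxE; under eq_bigr do rewrite mxE; move=> ->; rewrite scale0r.
by apply/existsP; apply: contraNT u0; rewrite negb_exists => /forallP h;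
   apply/eqP/rowP => i; rewrite mxE; apply/eqP; rewrite -[_ == _]negbK.
Qed.

Lemma lin_span_mono (A B : set M) v :
  (forall x, A x -> B x) -> lin_span A v -> lin_span B v.
Proof. by move=> AB [n [c [x [Ax ->]]]]; exists n, c, x; split=> // i; apply: AB. Qed.

Lemma lin_span_sum (A : set M) (I : Type) (r : seq I) (f : I -> M) :
  (forall i, lin_span A (f i)) -> lin_span A (\sum_(i <- r) f i).
Proof.
move=> hf; elim/big_ind: _ => //.
  by exists 0%N, (fun=> 0), (fun=> 0); split=> [[]//|]; rewrite big_ord0.
move=> _ _ [n [c [x [Ax ->]]]] [m [d [y [Ay ->]]]].
exists (n + m)%N, (fun i => match fintype.split i with inl j => c j | inr j => d j end),
  (fun i => match fintype.split i with inl j => x j | inr j => y j end).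
split=> [i|]; first by case: (fintype.split i).
rewrite big_split_ord /=; congr (_ + _); apply: eq_bigr => i _.
  by case: fintype.splitP => [j /= /val_inj <-//|j /= E]; have := ltn_ord i; lia.
by case: fintype.splitP => [j /= E|j /= /addnI/val_inj <-//]; have := ltn_ord j; lia.
Qed.

End FiniteDimension.

Section LinearMaps.
Variables (F : fieldType) (U W : lmodType F).

Definition lin_pack (f : U -> W) (lf : linear f) : {linear U -> W} :=
  HB.pack f (GRing.isLinear.Build F U W *:%R f lf).

Lemma lin_span_image (f : {linear U -> W}) (s : seq U) v :
  lin_span [set x | x \in s]%classic v ->
  lin_span [set x | x \in map f s]%classic (f v).
Proof.
move=> [n [c [x [xs ->]]]]; exists n, c, (f \o x); split=> [i /=|].
  exact/map_f/xs.
by rewrite linear_sum; apply: eq_bigr => i _; rewrite linearZ.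
Qed.

End LinearMaps.

Lemma can_linear_inv (F : fieldType) (U W : lmodType F) (f : {linear U -> W})
  (g : W -> U) : cancel f g -> cancel g f -> linear g.
Proof.
by move=> fK gK c x y; apply: (can_inj fK); rewrite linearP !gK.
Qed.

Section Modules.
Variables (F : numFieldType) (V : vertexAlg F) (omega : V).

Lemma mod_iso_inverse (M N : vmodule V) : mod_iso M N ->
  exists (f : {linear M -> N}) (g : {linear N -> M}),
    [/\ mod_hom f, mod_hom g, cancel f g & cancel g f].
Proof.
move=> [f [hf [g fK gK]]]; exists f, (lin_pack (can_linear_inv fK gK)); split=> //.
by move=> a n w; apply: (can_inj fK); rewrite /= hf !gK.
Qed.

(** Homomorphisms preserve L_0-eigenspaces, so decompositions and spanning lists of [W] are pushed
    forward by [p], and vanishing is tested after [io]. *)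
Lemma ordinary_retract (W M : vmodule V) (io : {linear M -> W}) (p : {linear W -> M}) :
  mod_hom io -> mod_hom p -> cancel io p -> vm_ordinary omega W -> vm_ordinary omega M.
Proof.
move=> hio hp ioK [dW fW bW].
have ioE h x : L0_eigenspace omega h x -> L0_eigenspace omega h (io x).
  by rewrite /L0_eigenspace /= -hio => ->; rewrite linearZ.
have pE h x : L0_eigenspace omega h x -> L0_eigenspace omega h (p x).
  by rewrite /L0_eigenspace /= -hp => ->; rewrite linearZ.
split.
- split.
  + move=> h; split=> [|c x y]; rewrite /L0_eigenspace /=.
      by rewrite linear0 scaler0.
    by move=> hx hy; rewrite vmact_linear_r hx hy scalerDr !scalerA mulrC.
  + move=> v; have [_ /(_ (io v)) [s [x [Sx vE]]] _] := dW.
    exists s, (p \o x); split=> [i /Sx /pE //|].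
    by rewrite -[LHS]ioK vE linear_sum.
  + move=> s x us Sx x0 i /[dup] is_ /Sx.
    have [_ _ /(_ s (io \o x) us) H] := dW => _.
    rewrite -[x i]ioK -[io _]/((io \o x) i) H ?linear0 //; first by move=> j /Sx /ioE.
    by rewrite -linear_sum x0 linear0.
- move=> h; have [s hs] := fW h; exists (map p s) => v /ioE /hs.
  by move=> /(lin_span_image p); rewrite ioK.
- move=> h; have [N hN] := bW h; exists N => n /hN H v /ioE /H /= v0.
  by rewrite -[v]ioK v0 linear0.
Qed.

End Modules.

(** A duplicate-free list of maximal length contains everything. This makes index sets of
    decompositions finite. *)
Lemma bounded_uniq_seq (I : eqType) (D : nat) :
  (forall t : seq I, uniq t -> (size t <= D)%N) ->
  exists2 s : seq I, uniq s & forall i, i \in s.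
Proof.
elim: D => [|D IH] hD.
  by exists [::] => // i; have := hD [:: i] isT.
have [hD'|/existsNP[s /not_implyP[us /negP]]] :=
  pselect (forall t : seq I, uniq t -> (size t <= D)%N); first exact: IH.
rewrite -ltnNge => hs; exists s => // i; apply: contraT => his.
by have := hD (i :: s); rewrite /= his us => /(_ isT); lia.
Qed.

(** * Finite decomposition of ordinary modules *)

Section Decomposition.
Variables (F : numFieldType) (V : vertexAlg F) (omega : V).
Hypothesis transl_omega : forall a : V, nprod omega 0 a = transl a.

Lemma L0_eigenvector_exists (M : vmodule V) :
  vm_ordinary omega M -> irreducible_mod M ->
  exists h : F, exists2 v : M, v != 0 & L0_eigenspace omega h v.
Proof.
move=> [dM _ _] [_ [w _ w0] _].
have [s [_ _ wE]] := dsum_proj_supp dM w.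
have [[h hh]|] := pselect (exists h, dsum_proj dM h w != 0).
  by exists h, (dsum_proj dM h w) => //; apply: dsum_proj_in.
move=> /forallNP H; case: w0; rewrite wE big1 // => h _.
by apply/eqP/negPn/negP/H.
Qed.

(** Nonzero vectors from distinct summands are independent, and here they all lie in one eigenspace
    spanned by [s]. *)
Lemma independent_eigenvectors_bound (W : vmodule V) (I : choiceType)
    (S : I -> set W) (y : I -> W) (h : F) (s : seq W) (t : seq I) :
  internal_dsum S -> (forall i, S i (y i)) -> (forall i, y i != 0) ->
  (forall v, L0_eigenspace omega h v -> lin_span [set x | x \in s]%classic v) ->
  uniq t -> (forall i, i \in t -> L0_eigenspace omega h (y i)) ->
  (size t <= size s)%N.
Proof.
move=> dS Sy y0 hs ut yt; rewrite leqNgt; apply/negP => st.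
pose x (i : 'I_(size t)) := y (tnth (in_tuple t) i).
have [|a ax [j aj]] := lin_span_dep (x := x) st.
  by move=> i; apply/hs/yt/mem_tnth.
move/(congr1 (dsum_proj dS (tnth (in_tuple t) j))): ax.
rewrite linear0 linear_sum (bigD1 j) //= [X in _ + X]big1 ?addr0.
  rewrite linearZ /= dsum_proj_id; last exact: Sy.
  by move/eqP; rewrite scaler_eq0 (negbTE aj) (negbTE (y0 _)).
move=> i ij; rewrite linearZ /= (dsum_proj_neq dS (i := tnth (in_tuple t) i)) ?scaler0 //.
by apply: contra_neq ij => /(tuple_uniqP (in_tuple t) ut).
Qed.

Variables (K : finType) (H : K -> vmodule V).
Hypothesis rational : va_rational omega.
Hypothesis H_ord : forall k, vm_ordinary omega (H k).
Hypothesis H_irr : forall k, irreducible_mod (H k).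
Hypothesis H_all : forall M : vmodule V, vm_ordinary omega M -> irreducible_mod M ->
  exists k, mod_iso M (H k).

(** The projection to a summand commutes with all modes, so the summand is a retract of [W], hence
    ordinary, and being irreducible it is some [H k]. The maps are packed in a sigma type to be
    chosen for all [i] at once. *)
Lemma irreducible_summand (W : vmodule V) (I : choiceType) (S : I -> set W)
    (dS : internal_dsum S) (i : I) :
  vm_ordinary omega W -> (forall j, irreducible_sub (S j)) ->
  exists t : {k : K & ({linear H k -> W} * {linear W -> H k})%type},
    [/\ mod_hom (tagged t).1, mod_hom (tagged t).2, injective (tagged t).1,
        forall x, S i ((tagged t).1 x)
      & forall w, (tagged t).1 ((tagged t).2 w) = dsum_proj dS i w].
Proof.
move=> oW irr; have hS j : vm_submodule (S j) by case: (irr j).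
pose r (w : W) : submod (hS i) := submod_sub (hS i) (dsum_proj_in dS i w).
have lr : linear r by move=> c x y; apply: val_inj; rewrite /= dsum_proj_linear.
have lv : linear (\val : submod (hS i) -> W) by move=> c x y.
have hr : mod_hom (lin_pack lr).
  move=> a n w; apply: val_inj => /=.
  apply: (dsum_proj_comm dS (T := vmact a n)) => j x.
  by case: (hS j) => _; apply.
have hv : mod_hom (lin_pack lv) by [].
have rK : cancel (lin_pack lv) (lin_pack lr).
  by move=> x; apply: val_inj; rewrite /= dsum_proj_id //; apply: submod_valP.
have oS := ordinary_retract hv hr rK oW.
have [k /mod_iso_inverse[f [g [hf hg fK gK]]]] :=
  H_all oS (submod_irreducible (hS i) (irr i)).
exists (existT _ k ((lin_pack lv \o g : {linear _ -> _}),
                    (f \o lin_pack lr : {linear _ -> _}))).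
split=> /= [a n w|a n w|x y|x|w] /=.
- by rewrite hg.
- by rewrite -hf; congr (f _); exact: hr.
- by move/val_inj/(can_inj gK).
- exact: submod_valP.
- by rewrite fK.
Qed.

(** Fix an L_0-eigenvector [v k] of weight [h k] in each [H k]. The summands of type [k] give
    independent vectors in the weight space [h k] of [W], whose finite dimension bounds their
    number. *)
Lemma ordinary_decomposition (W : vmodule V) : vm_ordinary omega W ->
  exists (n : nat) (c : 'I_n -> K) (io : forall i, {linear H (c i) -> W})
    (p : forall i, {linear W -> H (c i)}),
    [/\ forall i, mod_hom (io i), forall i, mod_hom (p i)
      & forall w, w = \sum_(i < n) io i (p i w)].
Proof.
move=> oW; have [I [S [irr dS]]] := rational (ordinary_admissible transl_omega oW).
pose t i := sval (cid (irreducible_summand dS i oW irr)).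
have tP i : [/\ mod_hom (tagged (t i)).1, mod_hom (tagged (t i)).2,
    injective (tagged (t i)).1, forall x, S i ((tagged (t i)).1 x)
    & forall w, (tagged (t i)).1 ((tagged (t i)).2 w) = dsum_proj dS i w].
  exact: svalP (cid (irreducible_summand dS i oW irr)).
pose c i := tag (t i).
have [h hP] := choice (fun k => L0_eigenvector_exists (H_ord k) (H_irr k)).
pose v k := s2val (cid2 (hP k)).
have v0 k : v k != 0 by exact: s2valP (cid2 (hP k)).
have vh k : L0_eigenspace omega (h k) (v k) by exact: s2valP' (cid2 (hP k)).
have [b bP] : exists b : K -> seq W, forall k w, L0_eigenspace omega (h k) w ->
    lin_span [set x | x \in b k]%classic w.
  by have [_ fW _] := oW; have [b hb] := choice (fun k => fW (h k)); exists b.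
pose y i := (tagged (t i)).1 (v (c i)).
have yS i : S i (y i) by have [_ _ _ + _] := tP i; apply.
have y0 i : y i != 0.
  have [_ _ inj _ _] := tP i; apply: contra_neq (v0 (c i)) => yi0.
  by apply: inj; rewrite linear0.
have yh i : L0_eigenspace omega (h (c i)) (y i).
  have [hom _ _ _ _] := tP i; rewrite /L0_eigenspace /= /y -hom.
  by rewrite (vh (c i)) linearZ.
have [s us sI] : exists2 s : seq I, uniq s & forall i, i \in s.
  apply: (bounded_uniq_seq (D := \sum_k size (b k))) => s us.
  rewrite -sum1_size (partition_big c xpredT) //=; apply: leq_sum => k _.
  rewrite -big_filter sum1_size.
  apply: (independent_eigenvectors_bound dS yS y0 (bP k)).
    exact: filter_uniq.
  by move=> i; rewrite mem_filter => /andP[/eqP <- _].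
pose e := tnth (in_tuple s).
exists (size s), (c \o e), (fun i => (tagged (t (e i))).1), (fun i => (tagged (t (e i))).2).
split=> [i|i|w]; try by case: (tP (e i)).
have [s' [us' s0 {1}->]] := dsum_proj_supp dS w.
rewrite (big_supp_sub us' us) //.
rewrite [LHS]big_tnth; apply: eq_bigr => i _.
by have [_ _ _ _ ->] := tP (e i).
Qed.

End Decomposition.

(** * Eigenvectors and Schur's lemma *)

Section Eigenvector.
Variables (F : closedFieldType) (M : lmodType F) (phi : {linear M -> M}).

(** This is p(phi) v, for a [phi] on a space that may be infinite-dimensional. *)
Let ev (p : {poly F}) (v : M) : M := \sum_(k < size p) p`_k *: iter k phi v.

Let evE (p : {poly F}) v n : (size p <= n)%N -> ev p v = \sum_(k < n) p`_k *: iter k phi v.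
Proof.
move=> pn; rewrite /ev -!(big_mkord xpredT (fun k => p`_k *: iter k phi v)).
rewrite [RHS](big_cat_nat _ (n := size p)) //= [X in _ + X]big_nat_cond.
rewrite [X in _ + X]big1 ?addr0 // => k /andP[/andP[kp _] _].
by rewrite nth_default ?scale0r.
Qed.

Let iter_linear k : linear (iter k phi).
Proof. by elim: k => // k IH c x y; rewrite !iterS IH linearP. Qed.

Let ev_XsubC (q : {poly F}) r v : ev (q * ('X - r%:P)) v = ev q (phi v - r *: v).
Proof.
have sz : (size (q * ('X - r%:P))%R <= (size q).+1)%N.
  by apply: leq_trans (size_polyMleq _ _) _; rewrite size_XsubC; lia.
rewrite (@evE _ _ _ sz) [RHS](@evE _ _ _ (leqnn _)) //.
pose g k := q`_k *: iter k phi v; rewrite mulrBr.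
transitivity (\sum_(k < size q) q`_k *: iter k.+1 phi v - r *: \sum_(k < size q) g k).
  under eq_bigr do rewrite coefB coefMC coefMX scalerBl.
  rewrite sumrB big_ord_recl /= scale0r add0r; congr (_ - _).
  rewrite big_ord_recr /= nth_default // mul0r scale0r addr0 scaler_sumr.
  by apply: eq_bigr => k _; rewrite /g scalerA mulrC.
rewrite scaler_sumr -sumrB; apply: eq_bigr => k _.
have -> : iter k phi (phi v - r *: v) = iter k phi (phi v) - r *: iter k phi v.
  by rewrite -!scaleNr [phi v + _]addrC iter_linear addrC.
by rewrite scalerBr -iterSr /g !scalerA mulrC.
Qed.

(** Split off a root r, p = q (X - r). Either (phi - r) v = 0, or q annihilates the nonzero vector
    (phi - r) v and has smaller degree. *)
Let ev_eigenvector n (p : {poly F}) v : (size p <= n)%N -> p != 0 -> v != 0 -> ev p v = 0 ->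
  exists r, exists2 w, w != 0 & phi w = r *: w.
Proof.
elim: n p v => [|n IH] p v; first by rewrite size_poly_leq0 => ->.
move=> pn p0 v0 pv.
have p1 : size p != 1%N.
  apply: contraNneq v0 => p1; move: pv; rewrite (@evE p v 1%N) ?p1 // big_ord1 /=.
  move=> /eqP; rewrite scaler_eq0 => /orP[/eqP c0|//]; case/eqP: p0.
  by apply/polyP => -[|i]; rewrite coef0 // nth_default // p1.
have [r /factor_theorem[q pE]] := closed_rootP p p1.
have [/eqP h|h] := eqVneq (phi v - r *: v) 0.
  by exists r, v => //; apply/eqP; rewrite -subr_eq0.
apply: (IH q (phi v - r *: v)) => //; last by rewrite -ev_XsubC -pE.
  move: pn; rewrite pE size_Mmonic ?monicXsubC // ?size_XsubC ?addn2 //.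
  by apply: contraNneq p0 => q0; rewrite pE q0 mul0r.
by apply: contraNneq p0 => q0; rewrite pE q0 mul0r.
Qed.

(** The first [(size s).+1] iterates of [v] are dependent, which is a nonzero polynomial in [phi]
    annihilating [v]. *)
Lemma eigenvector_in_fin_dim (s : seq M) (v : M) : v != 0 ->
  (forall k, lin_span [set y | y \in s]%classic (iter k phi v)) ->
  exists r, exists2 w, w != 0 & phi w = r *: w.
Proof.
move=> v0 hs.
have [//|a a0 [i ai]] := lin_span_dep (x := fun i : 'I_(size s).+1 => iter i phi v) (leqnn _).
pose p := \poly_(k < (size s).+1) (if insub k is Some i then a i else 0).
have pE (j : 'I_(size s).+1) : p`_j = a j by rewrite coef_poly ltn_ord valK.
apply: (@ev_eigenvector _ p v (leqnn _)) => //.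
  by apply: contraNneq ai => p0; rewrite -pE p0 coef0.
rewrite (evE v (size_poly _ _)); rewrite -[RHS]a0; apply: eq_bigr => j _.
by rewrite pE.
Qed.

End Eigenvector.

Section Schur.
Variables (F : numClosedFieldType) (V : vertexAlg F) (omega : V).

(** [phi] preserves a nonzero finite-dimensional L_0-eigenspace, so it has an eigenvector; its
    eigenspace is a nonzero submodule. *)
Lemma schur_scalar (M : vmodule V) (phi : {linear M -> M}) :
  vm_ordinary omega M -> irreducible_mod M -> mod_hom phi ->
  exists c, forall w, phi w = c *: w.
Proof.
move=> oM iM hphi; have [h [v v0 vh]] := L0_eigenvector_exists oM iM.
have [_ fM _] := oM; have [s hs] := fM h.
have [r [w w0 wr]] : exists r, exists2 w, w != 0 & phi w = r *: w.
  apply: (eigenvector_in_fin_dim (s := s) v0) => k; apply: hs.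
  elim: k => //= k IH; rewrite /L0_eigenspace /= -hphi.
  by rewrite IH linearZ.
exists r => x; have [_ _ irr] := iM.
have [| |H|H] := irr [set y | phi y = r *: y]%classic.
- split; first split=> /=; first by rewrite linear0 scaler0.
    by move=> c y z /= hy hz; rewrite linearP hy hz scalerDr !scalerA mulrC.
  by move=> a n y /= hy; rewrite hphi hy linearZ.
- by [].
- by have /eqP := H w wr; rewrite (negbTE w0).
by have : setT x by []; rewrite -H.
Qed.

Lemma schur_zero_or_iso (M N : vmodule V) (f : {linear M -> N}) :
  irreducible_mod M -> irreducible_mod N -> mod_hom f ->
  (forall w, f w = 0) \/ mod_iso M N.
Proof.
move=> [_ _ iM] [_ _ iN] hf.
have [||inj|E] := iM [set x | f x = 0]%classic; last 1 first.
- by left=> w; have : setT w by []; rewrite -E.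
- split; first split=> /=; first by rewrite linear0.
    by move=> c y z /= hy hz; rewrite linearP hy hz scaler0 addr0.
  by move=> a n y /= hy; rewrite hf hy linear0.
- by [].
have injf : injective f.
  move=> x y xy; apply/eqP; rewrite -subr_eq0; apply/eqP/inj => /=.
  by rewrite linearB xy subrr.
have [||im0|E] := iN (range f).
- split; first split; first by exists 0 => //; rewrite linear0.
    by move=> c _ _ [y _ <-] [z _ <-]; exists (c *: y + z) => //; rewrite linearP.
  by move=> a n _ [y _ <-]; exists (vmact a n y); rewrite ?hf.
- by [].
- by left=> w; apply: im0; exists w.
right; exists f; split=> //.
have surj y : exists x, f x = y by have : setT y by []; rewrite -E => -[x _]; exists x.
have [g gK] := choice surj.
by exists g => // x; apply: injf.
Qed.

End Schur.

(** * Finite products of modules *)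

Definition dfamily (K : Type) (T : K -> Type) := forall k, T k.

Section FamilyLmodule.
Variables (F : fieldType) (K : Type) (T : K -> lmodType F).
Local Notation car := (dfamily T).

HB.instance Definition _ := gen_eqMixin car.
HB.instance Definition _ := gen_choiceMixin car.

Definition dfamily_zero : car := fun k => 0.
Definition dfamily_opp (f : car) : car := fun k => - f k.
Definition dfamily_add (f g : car) : car := fun k => f k + g k.
Definition dfamily_scale (c : F) (f : car) : car := fun k => c *: f k.

Fact dfamily_addA : associative dfamily_add.
Proof. by move=> f g h; apply: functional_extensionality_dep => k; apply: addrA. Qed.
Fact dfamily_addC : commutative dfamily_add.
Proof. by move=> f g; apply: functional_extensionality_dep => k; apply: addrC. Qed.
Fact dfamily_add0 : left_id dfamily_zero dfamily_add.
Proof. by move=> f; apply: functional_extensionality_dep => k; apply: add0r. Qed.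
Fact dfamily_addN : left_inverse dfamily_zero dfamily_opp dfamily_add.
Proof. by move=> f; apply: functional_extensionality_dep => k; apply: addNr. Qed.

HB.instance Definition _ := GRing.isZmodule.Build car
  dfamily_addA dfamily_addC dfamily_add0 dfamily_addN.

Fact dfamily_scaleA c d f :
  dfamily_scale c (dfamily_scale d f) = dfamily_scale (c * d) f.
Proof. by apply: functional_extensionality_dep => k; apply: scalerA. Qed.
Fact dfamily_scale1 : left_id 1 dfamily_scale.
Proof. by move=> f; apply: functional_extensionality_dep => k; apply: scale1r. Qed.
Fact dfamily_scaleDr : right_distributive dfamily_scale +%R.
Proof. by move=> c f g; apply: functional_extensionality_dep => k; apply: scalerDr. Qed.
Fact dfamily_scaleDl f : {morph dfamily_scale^~ f : c d / c + d}.
Proof. by move=> c d; apply: functional_extensionality_dep => k; apply: scalerDl. Qed.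

HB.instance Definition _ := GRing.Zmodule_isLmodule.Build F car
  dfamily_scaleA dfamily_scale1 dfamily_scaleDr dfamily_scaleDl.

Definition dfamily_eval (k : K) (f : car) : T k := f k.
Lemma dfamily_eval_linear k : linear (dfamily_eval k).
Proof. by []. Qed.
HB.instance Definition _ k :=
  GRing.isLinear.Build F car (T k) *:%R (dfamily_eval k) (dfamily_eval_linear k).

Lemma dfamilyP (f g : car) : (forall k, dfamily_eval k f = dfamily_eval k g) -> f = g.
Proof. exact: functional_extensionality_dep. Qed.

End FamilyLmodule.

Lemma fin_bound (K : finType) (P : K -> nat -> Prop) :
  (forall k, exists N, forall n, (N <= n)%N -> P k n) ->
  exists N, forall n, (N <= n)%N -> forall k, P k n.
Proof.
move=> /choice[f fP]; exists (\max_k f k) => n hn k; apply: fP.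
exact: leq_trans (leq_bigmax k) hn.
Qed.

Section ProductModule.
Variables (F : numFieldType) (V : vertexAlg F) (omega : V).
Variables (K : finType) (H : K -> vmodule V).
Local Notation car := (dfamily (fun k => H k : lmodType F)).

Definition prodmod_act (a : V) (n : int) (w : car) : car := fun k => vmact a n (w k).

Fact prodmod_act_linear_r a n : linear (prodmod_act a n).
Proof. by move=> c x y; apply: dfamilyP => k; apply: vmact_linear_r. Qed.

Fact prodmod_act_linear_l n w : linear (fun a => prodmod_act a n w).
Proof. by move=> c x y; apply: dfamilyP => k; apply: vmact_linear_l. Qed.

Fact prodmod_act_trunc a w : exists N : nat, forall n : nat, (N <= n)%N ->
  prodmod_act a n%:Z w = 0.
Proof.
have [N hN] := fin_bound (fun k => vmact_trunc a (w k)).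
by exists N => n /hN h; apply: dfamilyP => k; apply: h.
Qed.

Fact prodmod_act_vac n w : prodmod_act (vac V) n w = if n == -1 then w else 0.
Proof.
by apply: dfamilyP => k; rewrite /dfamily_eval /prodmod_act vmact_vac; case: ifP.
Qed.

Lemma eq_finsums_dfamily (f g : nat -> car) :
  (forall k, eq_finsums (fun j => f j k) (fun j => g j k)) -> eq_finsums f g.
Proof.
move=> /fin_bound[N hN]; exists N => n /hN h; apply: dfamilyP => k.
by rewrite !linear_sum; apply: h.
Qed.

Fact prodmod_act_borcherds (a b : V) (w : car) (l m n : int) :
  eq_finsums
    (fun j => binz F m j *: prodmod_act (nprod a (l + j%:Z) b) (m + n - j%:Z) w)
    (fun j => ((-1) ^+ j * binz F l j) *:
       (prodmod_act a (m + l - j%:Z) (prodmod_act b (n + j%:Z) w)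
        - (-1) ^ l *: prodmod_act b (n + l - j%:Z) (prodmod_act a (m + j%:Z) w))).
Proof. by apply: eq_finsums_dfamily => k; apply: vmact_borcherds. Qed.

Definition prodmod : vmodule V := VModule prodmod_act_linear_r prodmod_act_linear_l
  prodmod_act_trunc prodmod_act_vac prodmod_act_borcherds.

Definition prodmod_proj (k : K) : {linear prodmod -> H k} :=
  @dfamily_eval F K (fun k => H k : lmodType F) k.

Lemma prodmod_projP (x y : prodmod) :
  (forall k, prodmod_proj k x = prodmod_proj k y) -> x = y.
Proof. exact: dfamilyP. Qed.

Lemma prodmod_proj_hom k : mod_hom (prodmod_proj k).
Proof. by []. Qed.

Definition prodmod_incl_fun (k : K) (x : H k) : prodmod :=
  @dfwith K (fun k => H k) (fun k => 0) k x.

Lemma prodmod_incl_in k (x : H k) : prodmod_proj k (prodmod_incl_fun x) = x.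
Proof. exact: dfwith_in. Qed.

Lemma prodmod_incl_out k k' (x : H k) : k != k' ->
  prodmod_proj k' (prodmod_incl_fun x) = 0.
Proof. exact: dfwith_out. Qed.

Lemma prodmod_incl_linear k : linear (@prodmod_incl_fun k).
Proof.
move=> c x y; apply: prodmod_projP => k'; rewrite linearP.
have [<-|kk'] := eqVneq k k'; first by rewrite !prodmod_incl_in.
by rewrite !prodmod_incl_out // scaler0 addr0.
Qed.

Definition prodmod_incl k : {linear H k -> prodmod} := lin_pack (@prodmod_incl_linear k).

Lemma prodmod_incl_hom k : mod_hom (prodmod_incl k).
Proof.
move=> a n w; apply: prodmod_projP => k'; rewrite prodmod_proj_hom /=.
have [<-|kk'] := eqVneq k k'; first by rewrite !prodmod_incl_in.
by rewrite !prodmod_incl_out // linear0.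
Qed.

Lemma prodmod_sum_incl (x : prodmod) :
  x = \sum_k prodmod_incl k (prodmod_proj k x).
Proof.
apply: prodmod_projP => k; rewrite linear_sum (bigD1 k) //= prodmod_incl_in.
by rewrite big1 ?addr0 // => k' kk'; rewrite prodmod_incl_out.
Qed.

(** The L_0-eigenspaces of the product are the products of those of the factors; supports, spanning
    lists and bounds are merged over the finitely many factors. *)
Lemma prodmod_ordinary : (forall k, vm_ordinary omega (H k)) ->
  vm_ordinary omega prodmod.
Proof.
move=> oH; have dH k : internal_dsum (L0_eigenspace omega (M := H k)).
  by case: (oH k).
have eigE h (x : prodmod) : L0_eigenspace omega h x <->
    forall k, L0_eigenspace omega h (prodmod_proj k x).
  split=> [hx k|hx]; first by rewrite /L0_eigenspace /= -prodmod_proj_hom hx linearZ.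
  by apply: prodmod_projP => k; rewrite prodmod_proj_hom hx linearZ.
split.
- split.
  + move=> h; have sub k : vsubspace (L0_eigenspace omega (M := H k) h).
      by case: (dH k).
    split=> [|c x y /eigE hx /eigE hy]; apply/eigE => k; have [S0 SD] := sub k.
      by rewrite linear0.
    by rewrite linearP; apply: SD.
  + move=> x; pose s k := sval (cid (dsum_proj_supp (dH k) (prodmod_proj k x))).
    pose r := undup (flatten [seq s k | k <- enum K]).
    exists r, (fun h => (fun k => dsum_proj (dH k) h (prodmod_proj k x)) : prodmod).
    split=> [h _|]; first by apply/eigE => k; apply: (dsum_proj_in (dH k)).
    apply: prodmod_projP => k; rewrite linear_sum /=.
    have [us s0 xE] := svalP (cid (dsum_proj_supp (dH k) (prodmod_proj k x))).
    rewrite {1}xE; apply: big_supp_sub => //; first exact: undup_uniq.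
    move=> h hs; rewrite mem_undup; apply/flattenP; exists (s k) => //.
    by apply: map_f; rewrite mem_enum.
  + move=> t x ut tx x0 h ht; apply: prodmod_projP => k; rewrite linear0.
    have [_ _ /(_ t (fun h => prodmod_proj k (x h)) ut)] := dH k; apply=> //.
      by move=> h' /tx /eigE.
    by rewrite -linear_sum x0 linear0.
- move=> h; have fH k : fin_dim (L0_eigenspace omega (M := H k) h) by case: (oH k).
  pose s k := sval (cid (fH k)).
  have hs k x : L0_eigenspace omega h x -> lin_span [set y | y \in s k]%classic x.
    exact: (svalP (cid (fH k))).
  exists (flatten [seq map (prodmod_incl k) (s k) | k <- enum K]) => x /eigE hx.
  rewrite [x]prodmod_sum_incl; apply: lin_span_sum => k.
  have := lin_span_image (prodmod_incl k) (hs k _ (hx k)).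
  apply: lin_span_mono => y /= ys.
  apply/flattenP; exists (map (prodmod_incl k) (s k)); last exact: ys.
  by apply/mapP; exists k; rewrite ?mem_enum.
- move=> h; have bH k : exists N, forall n : nat, (N <= n)%N -> forall x,
      L0_eigenspace (M := H k) omega (h - n%:R) x -> x = 0.
    by case: (oH k) => _ _ /(_ h).
  have [N hN] := fin_bound bH.
  exists N => n /hN b x /eigE hx; apply: prodmod_projP => k.
  by rewrite linear0; apply: b.
Qed.

End ProductModule.

(** * Fusion products *)

Section Intertwining.
Variables (F : numFieldType) (V : vertexAlg F) (omega : V) (M1 M2 : vmodule V).

Lemma intertwining_comp (P W : vmodule V) (Y : F -> M1 -> M2 -> P) (f : {linear P -> W}) :
  mod_hom f -> intertwining omega Y -> intertwining omega (fun x w1 w2 => f (Y x w1 w2)).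
Proof.
move=> hf [Yr Yl Yt Yd Yb]; split.
- by move=> x w1 c y z; rewrite Yr linearP.
- by move=> x w2 c y z; rewrite Yl linearP.
- by move=> x w1 w2; have [N hN] := Yt x w1 w2; exists N => n /hN ->; rewrite linear0.
- by move=> x w1 w2; rewrite Yd linearZ.
move=> a w1 w2 l m x; have [N0 hN] := Yb a w1 w2 l m x; exists N0 => N /hN.
move/(congr1 f); rewrite !linear_sum.
under eq_bigr do rewrite linearZ.
under [X in _ = X -> _]eq_bigr do rewrite linearZ linearB hf linearZ.
by [].
Qed.

Lemma intertwining_prodmod (K : finType) (H : K -> vmodule V)
    (Y : F -> M1 -> M2 -> prodmod H) :
  (forall k, intertwining omega (fun x w1 w2 => prodmod_proj H k (Y x w1 w2))) ->
  intertwining omega Y.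
Proof.
move=> hY; split.
- move=> x w1 c y z; apply: prodmod_projP => k; rewrite linearP.
  by case: (hY k) => /(_ x w1 c y z).
- move=> x w2 c y z; apply: prodmod_projP => k; rewrite linearP.
  by case: (hY k) => _ /(_ x w2 c y z).
- move=> x w1 w2; have hk k : exists N : nat, forall n : nat, (N <= n)%N ->
      prodmod_proj H k (Y (x + n%:R) w1 w2) = 0.
    by case: (hY k).
  have [N hN] := fin_bound hk; exists N => n /hN h.
  by apply: prodmod_projP => k; rewrite h linear0.
- move=> x w1 w2; apply: prodmod_projP => k; rewrite linearZ.
  by case: (hY k).
move=> a w1 w2 l m x; apply: eq_finsums_dfamily => k.
by case: (hY k) => _ _ _ _ /(_ a w1 w2 l m x).
Qed.

End Intertwining.

Section Fusion.
Variables (F : numClosedFieldType) (V : vertexAlg F) (omega : V).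
Hypothesis transl_omega : forall a : V, nprod omega 0 a = transl a.
Variables (K : finType) (H : K -> vmodule V).
Hypothesis rational : va_rational omega.
Hypothesis H_ord : forall k, vm_ordinary omega (H k).
Hypothesis H_irr : forall k, irreducible_mod (H k).
Hypothesis H_all : forall M : vmodule V, vm_ordinary omega M -> irreducible_mod M ->
  exists k, mod_iso M (H k).
Hypothesis H_inj : forall k k', mod_iso (H k) (H k') -> k = k'.

Variables (M1 M2 : vmodule V) (mult : K -> nat).
Hypothesis dimI : forall k, dim_intertwining omega M1 M2 (H k) (mult k).

Local Notation index := {k : K & 'I_(mult k)}.
(** The candidate fusion product has one copy of [H k] for each basis element of the intertwining
    operators into [H k]. *)
Definition isotypic_sum : vmodule V := prodmod (fun i : index => H (tag i)).
Local Notation P := isotypic_sum.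

Definition isotypic_proj k (j : 'I_(mult k)) : {linear P -> H k} :=
  prodmod_proj (fun i : index => H (tag i)) (existT _ k j).

Definition isotypic_incl k (j : 'I_(mult k)) : {linear H k -> P} :=
  prodmod_incl (fun i : index => H (tag i)) (existT _ k j).

Lemma isotypic_proj_hom k (j : 'I_(mult k)) : mod_hom (isotypic_proj j).
Proof. by []. Qed.

Lemma isotypic_incl_hom k (j : 'I_(mult k)) : mod_hom (isotypic_incl j).
Proof. exact: (prodmod_incl_hom (k := existT _ k j)). Qed.

Lemma isotypic_sumE (x : forall k, 'I_(mult k) -> H k) :
  \sum_k \sum_(j < mult k) isotypic_incl j (x k j) = (fun i => x (tag i) (tagged i)) :> P.
Proof.
rewrite [RHS]prodmod_sum_incl.
rewrite (sig_big_dep (J := fun k => 'I_(mult k) : finType) xpredT (fun _ => xpredT)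
  (fun k j => isotypic_incl j (x k j))) /=.
by apply: eq_bigr => -[k j] _.
Qed.

Lemma isotypic_proj_sum (x : forall k, 'I_(mult k) -> H k) k (j : 'I_(mult k)) :
  isotypic_proj j (\sum_k \sum_(j < mult k) isotypic_incl j (x k j)) = x k j.
Proof. by rewrite isotypic_sumE. Qed.

Lemma isotypic_sum_incl (x : P) :
  x = \sum_k \sum_(j < mult k) isotypic_incl j (isotypic_proj j x).
Proof. by rewrite isotypic_sumE; apply: prodmod_projP => -[k j]. Qed.

(** By Schur's lemma the restriction of [psi] to a copy of [H k'] is a scalar for k' = k and zero
    otherwise, by [H_inj]. *)
Lemma hom_isotypic_sum (k : K) (psi : {linear P -> H k}) : mod_hom psi ->
  exists a : {ffun 'I_(mult k) -> F},
    forall x, psi x = \sum_j a j *: isotypic_proj j x.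
Proof.
move=> hpsi.
have hj (j : 'I_(mult k)) : exists a, forall x, psi (isotypic_incl j x) = a *: x.
  apply: (schur_scalar (phi := psi \o isotypic_incl j) (H_ord k)) => //.
  by move=> b n w; rewrite /= -hpsi -isotypic_incl_hom.
have [a ha] := choice hj.
exists [ffun j => a j] => x; rewrite {1}[x]isotypic_sum_incl linear_sum.
rewrite (bigD1 k) //= [X in _ + X]big1 ?addr0 => [|k' kk'].
  by rewrite linear_sum; apply: eq_bigr => j _; rewrite ffunE ha.
rewrite linear_sum big1 // => j _.
have hom : mod_hom (psi \o isotypic_incl j).
  by move=> b n w; rewrite /= -hpsi -isotypic_incl_hom.
have [z|/H_inj E] := schur_zero_or_iso (H_irr k') (H_irr k) hom; first exact: z.
by rewrite E eqxx in kk'.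
Qed.

Definition isotypic_basis k : 'I_(mult k) -> F -> M1 -> M2 -> H k := sval (cid (dimI k)).

Lemma isotypic_basis_intertwining k (j : 'I_(mult k)) :
  intertwining omega (isotypic_basis j).
Proof. have [h _] := svalP (cid (dimI k)); exact: (h j). Qed.

Lemma isotypic_basisP k (Y : F -> M1 -> M2 -> H k) : intertwining omega Y ->
  exists! c : {ffun 'I_(mult k) -> F},
    forall x w1 w2, Y x w1 w2 = \sum_i c i *: isotypic_basis i x w1 w2.
Proof. have [_] := svalP (cid (dimI k)); apply. Qed.

Definition fusion_op (x : F) (w1 : M1) (w2 : M2) : P :=
  fun i => isotypic_basis (tagged i) x w1 w2.

Lemma fusion_op_intertwining : intertwining omega fusion_op.
Proof. by apply: intertwining_prodmod => -[k j]; apply: isotypic_basis_intertwining. Qed.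

(** If [psi] is a combination of projections, its composite with [fusion_op] is the same combination
    of basis operators, so all coefficients vanish. This supplies uniqueness in the universal
    property. *)
Lemma hom_fusion_op_eq0 k (psi : {linear P -> H k}) : mod_hom psi ->
  (forall x w1 w2, psi (fusion_op x w1 w2) = 0) -> forall w, psi w = 0.
Proof.
move=> hpsi psi0; have [a ha] := hom_isotypic_sum hpsi.
have I0 := intertwining_comp hpsi fusion_op_intertwining.
have [c [_ cU]] := isotypic_basisP I0.
have ca : c = a by apply: cU => x w1 w2; rewrite ha.
have c0 : c = [ffun=> 0].
  apply: cU => x w1 w2; rewrite psi0 big1 // => i _; by rewrite ffunE scale0r.
by move=> w; rewrite ha -ca c0 big1 // => j _; rewrite ffunE scale0r.
Qed.

Theorem fusion_product_isotypic_sum : fusion_product omega fusion_op.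
Proof.
split; [exact: prodmod_ordinary|exact: fusion_op_intertwining|].
move=> W X oW hX.
have [n [c [io [p [hio hp ioE]]]]] :=
  ordinary_decomposition transl_omega rational H_ord H_irr H_all oW.
have hc i : exists b : {ffun 'I_(mult (c i)) -> F}, forall x w1 w2,
    p i (X x w1 w2) = \sum_j b j *: isotypic_basis j x w1 w2.
  by have [b [hb _]] := isotypic_basisP (intertwining_comp (hp i) hX); exists b.
pose b i := sval (cid (hc i)).
have bP i x w1 w2 : p i (X x w1 w2) = \sum_j b i j *: isotypic_basis j x w1 w2.
  exact: (svalP (cid (hc i))).
(* Replacing each basis operator in the expansion of [p i (X x w1 w2)] by the matching projection
   gives the factorisation. *)
pose f (w : P) : W := \sum_(i < n) io i (\sum_j b i j *: isotypic_proj j w).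
have lf : linear f.
  move=> a y z; rewrite /f scaler_sumr -big_split; apply: eq_bigr => i _ /=.
  rewrite -linearP; congr (io i _); rewrite scaler_sumr -big_split.
  by apply: eq_bigr => j _; rewrite linearP.
have hf : mod_hom (lin_pack lf).
  move=> a m w; rewrite /= /f [RHS]linear_sum; apply: eq_bigr => i _.
  rewrite [RHS]/= -hio; congr (io i _); rewrite [RHS]linear_sum.
  by apply: eq_bigr => j _; rewrite isotypic_proj_hom [RHS]linearZ.
have fE x w1 w2 : X x w1 w2 = lin_pack lf (fusion_op x w1 w2).
  by rewrite [LHS]ioE; apply: eq_bigr => i _; rewrite bP.
exists (lin_pack lf); split=> // g hg gE w; apply/eqP; rewrite -subr_eq0; apply/eqP.
(* The difference of two factorisations vanishes on all values of [fusion_op], so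
   [hom_fusion_op_eq0] annihilates each component [p i \o d]. *)
pose d : {linear P -> W} := g \- lin_pack lf.
have hd : mod_hom d.
  move=> a m v; rewrite -[LHS]/(g _ - lin_pack lf _) hg hf.
  by rewrite -[d v]/(g v - lin_pack lf v) linearB.
rewrite -[LHS]/(d w) [LHS]ioE big1 // => i _.
have hpd : mod_hom (p i \o d).
  by move=> a m v; rewrite -[LHS]/(p i (d _)) hd hp.
rewrite -[p i _]/((p i \o d) w) (hom_fusion_op_eq0 hpd); first by rewrite linear0.
by move=> x w1 w2; rewrite -[LHS]/(p i (g _ - lin_pack lf _)) -gE -fE subrr linear0.
Qed.

(** Two universal operators factor through each other, and uniqueness makes the two factorisations
    mutually inverse. *)
Theorem fusion_product_iso_dsum (P' : vmodule V) (Y : F -> M1 -> M2 -> P') :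
  fusion_product omega Y -> iso_dsum P' H mult.
Proof.
move=> [oP' hY univ]; have [oP hop univ0] := fusion_product_isotypic_sum.
have [f [hf fE _]] := univ0 _ _ oP' hY.
have [g [hg gE _]] := univ _ _ oP hop.
have fK : cancel f g.
  have [e [_ _ eU]] := univ0 _ _ oP hop.
  have gf w : (g \o f) w = e w.
    by apply: eU => [a n v|x w1 w2] /=; [rewrite hf hg|rewrite -fE -gE].
  have id w : (idfun : {linear P -> P}) w = e w by apply: eU.
  by move=> w; rewrite -[LHS]/((g \o f) w) gf -id.
have gK : cancel g f.
  have [e [_ _ eU]] := univ _ _ oP' hY.
  have fg w : (f \o g) w = e w.
    by apply: eU => [a n v|x w1 w2] /=; [rewrite hg hf|rewrite -gE -fE].
  have id w : (idfun : {linear P' -> P'}) w = e w by apply: eU.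
  by move=> w; rewrite -[LHS]/((f \o g) w) fg -id.
exists (fun k j => f \o isotypic_incl j); split=> [k j a n w|w].
  by rewrite -[LHS]/(f (isotypic_incl j _)) isotypic_incl_hom hf.
have sumE (x : forall k, 'I_(mult k) -> H k) :
    \sum_k \sum_(j < mult k) (f \o isotypic_incl j) (x k j) =
    f (\sum_k \sum_(j < mult k) isotypic_incl j (x k j)).
  by rewrite linear_sum; apply: eq_bigr => k _; rewrite linear_sum.
split=> [|x y].
  exists (fun k j => isotypic_proj j (g w)).
  by rewrite sumE -isotypic_sum_incl gK.
rewrite !sumE => -> /(can_inj fK) xy k j.
by rewrite -(isotypic_proj_sum x) xy isotypic_proj_sum.
Qed.

End Fusion.

(** * S-matrices and the Verlinde sums *)

Section Expi.
Variable R : realType.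
Implicit Types a b : R.

Lemma expi0 : expi (0 : R) = 1.
Proof. by rewrite /expi cos0 sin0. Qed.

Lemma expiD a b : expi (a + b) = expi a * expi b.
Proof.
by rewrite /expi cosD sinD; apply/eqP; rewrite eq_complex /= [_ * sin b + _]addrC eqxx eqxx.
Qed.

Lemma expiN a : expi (- a) = (expi a)^*%C.
Proof. by rewrite /expi cosN sinN. Qed.

Lemma expi_neq0 a : expi a != 0.
Proof.
apply/eqP => a0; have := expiD a (- a); rewrite subrr expi0 a0 mul0r => /eqP.
by rewrite oner_eq0.
Qed.

Lemma expi_conj a : expi a * (expi a)^*%C = 1.
Proof. by rewrite -expiN -expiD subrr expi0. Qed.

Lemma expi_2pi (k : int) : expi (2 * pi * k%:~R : R) = 1.
Proof.
have e1 : expi (2 * pi : R) = 1.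
  by rewrite /expi mulr_natl cos2pi mulr2n sinD sinpi mul0r mulr0 addr0.
have en (n : nat) : expi (2 * pi * n%:R : R) = 1.
  elim: n => [|n IH]; first by rewrite mulr0 expi0.
  by rewrite -[n.+1%:R]natr1 [_ * (_ + 1)]mulrDr mulr1 expiD IH e1 mulr1.
case: k => n; first exact: en.
by rewrite NegzE rmorphN /= mulrN expiN en rmorph1.
Qed.

(** With k the floor of a / (2 pi), the number c = a/2 - pi k lies in [0, pi). From cos (2c) = 1
    follows sin c = 0, and the sine is positive on (0, pi), so c = 0. *)
Lemma expi_eq1 a : expi a = 1 -> exists k : int, a = 2 * pi * k%:~R.
Proof.
move=> ea; have pi0 : 0 < pi :> R by exact: pi_gt0.
have p0 : 0 < 2 * pi :> R by rewrite mulr_gt0.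
have aE : a = 2 * pi * (a / (2 * pi)) by rewrite mulrC divfK ?gt_eqF.
have := floor_itv (a / (2 * pi)); set k := Num.floor _ => /andP[k1 k2].
exists k; pose c := a / 2 - pi * k%:~R.
have cE : c *+ 2 = a + 2 * pi * (- k)%:~R by rewrite /c -mulr_natl rmorphN /=; field.
have : expi (c *+ 2) = 1 by rewrite cE expiD ea expi_2pi mulr1.
move=> /(congr1 (@complex.Re R)) /=; rewrite cos_mulr2n => cos1.
have sin0 : sin c = 0.
  apply/eqP; rewrite -sqrf_eq0; apply/eqP; have := cos2Dsin2 c; lra.
have c0 : c = pi * (a / (2 * pi) - k%:~R).
  have E (p k' : R) : p != 0 -> a / 2 - p * k' = p * (a / (2 * p) - k').
    by move=> ?; field.
  by rewrite -E ?gt_eqF.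
have [kE|kE] := eqVneq (a / (2 * pi) - k%:~R) 0.
  by rewrite aE; congr (_ * _); apply/eqP; rewrite -subr_eq0 kE.
have d0 : 0 < a / (2 * pi) - k%:~R by rewrite lt_def kE subr_ge0.
have d1 : a / (2 * pi) - k%:~R < 1 by rewrite rmorphD /= in k2; rewrite ltrBlDl.
have := @sin_gt0_pi _ c; rewrite sin0 ltxx c0 mulr_gt0 // -[X in _ < X]mulr1.
by rewrite ltr_pM2l // d1 => /(_ isT).
Qed.

End Expi.

(** * Alternating sums over the Weyl group *)

Lemma det_fun33 (C : comPzRingType) (f : nat -> nat -> C) :
  \det (\matrix_(i < 3, j < 3) f i j) =
    f 0%N 0%N * (f 1%N 1%N * f 2%N 2%N - f 1%N 2%N * f 2%N 1%N)
  - f 0%N 1%N * (f 1%N 0%N * f 2%N 2%N - f 1%N 2%N * f 2%N 0%N)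
  + f 0%N 2%N * (f 1%N 0%N * f 2%N 1%N - f 1%N 1%N * f 2%N 0%N).
Proof.
rewrite (expand_det_row _ ord0) !big_ord_recl big_ord0.
rewrite /cofactor !(expand_det_row _ ord0) !big_ord_recl !big_ord0.
rewrite /cofactor !det_mx11 !mxE /= /bump /=.
by rewrite !expr0 !expr1 !expr2 /=; ring.
Qed.

(* The alternating sum of [e <w y, x>] over S_3, where [y] has integral coordinates
   [2m+n, n-m, -m-2n] and [x] is [(p+q, q, 0)]; [y] is three times the weight
   [m omega_1 + n omega_2] and [x] is [p omega_1 + q omega_2] up to a shift. *)
Definition weyl_alt (C : nzRingType) (e : int -> C) (m n p q : int) : C :=
  e ((2 * m + n) * (p + q) + (n - m) * q)
  - e ((2 * m + n) * (p + q) + (- m - 2 * n) * q)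
  - e ((n - m) * (p + q) + (2 * m + n) * q)
  + e ((n - m) * (p + q) + (- m - 2 * n) * q)
  + e ((- m - 2 * n) * (p + q) + (2 * m + n) * q)
  - e ((- m - 2 * n) * (p + q) + (n - m) * q).

Section WeylAlt.
Variables (C : fieldType) (e : int -> C).
Implicit Types m n p q : int.

(** Up to a shift by a multiple of (1, 1, 1), which pairs to zero with y, this exchanges the first
    and last coordinates of x, an odd permutation. *)
Lemma weyl_alt_swap m n p q : weyl_alt e m n (- q) (- p) = - weyl_alt e m n p q.
Proof.
have -> : weyl_alt e m n (- q) (- p) =
    e ((- m - 2 * n) * (p + q) + (n - m) * q)
    - e ((n - m) * (p + q) + (- m - 2 * n) * q)
    - e ((- m - 2 * n) * (p + q) + (2 * m + n) * q)
    + e ((2 * m + n) * (p + q) + (- m - 2 * n) * q)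
    + e ((n - m) * (p + q) + (2 * m + n) * q)
    - e ((2 * m + n) * (p + q) + (n - m) * q).
  by rewrite /weyl_alt; congr (e _ - e _ - e _ + e _ + e _ - e _); ring.
by rewrite /weyl_alt; ring.
Qed.

(** Up to a shift, the coordinates of x are permuted cyclically, an even permutation. *)
Lemma weyl_alt_rot m n p q : weyl_alt e m n q (- p - q) = weyl_alt e m n p q.
Proof.
have -> : weyl_alt e m n q (- p - q) =
    e ((- m - 2 * n) * (p + q) + (2 * m + n) * q)
    - e ((n - m) * (p + q) + (2 * m + n) * q)
    - e ((- m - 2 * n) * (p + q) + (n - m) * q)
    + e ((2 * m + n) * (p + q) + (n - m) * q)
    + e ((n - m) * (p + q) + (- m - 2 * n) * q)
    - e ((2 * m + n) * (p + q) + (- m - 2 * n) * q).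
  by rewrite /weyl_alt; congr (e _ - e _ - e _ + e _ + e _ - e _); ring.
by rewrite /weyl_alt; ring.
Qed.

(** On each of the three walls q = 0, p = 0 and p + q = 0, the vector x has two equal coordinates
    and the terms cancel in pairs. *)
Lemma weyl_alt0r m n p : weyl_alt e m n p 0 = 0.
Proof. by rewrite /weyl_alt !mulr0 !addr0; ring. Qed.

Lemma weyl_alt0l m n q : weyl_alt e m n 0 q = 0.
Proof.
have -> : weyl_alt e m n 0 q =
    e ((m + 2 * n) * q) - e ((m - n) * q) - e ((m + 2 * n) * q)
    + e ((- (2 * m) - n) * q) + e ((m - n) * q) - e ((- (2 * m) - n) * q).
  by rewrite /weyl_alt; congr (e _ - e _ - e _ + e _ + e _ - e _); ring.
by ring.
Qed.

Lemma weyl_altN m n p : weyl_alt e m n p (- p) = 0.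
Proof. by rewrite /weyl_alt subrr !mulr0 !add0r; ring. Qed.

Hypothesis eD : forall x y, e (x + y) = e x * e y.
Variable u : int.
Hypothesis e_period : forall x, e (3 * u * x) = 1.

(** The vector x moves by u (1, 0, 0), and all coordinates of y are congruent to n - m modulo 3, so
    every term gains the same factor. In [weyl_alt_period_r] the shift is u (1, 1, 0), which gives
    the square. *)
Lemma weyl_alt_period_l m n p q :
  weyl_alt e m n (p + u) q = e (u * (n - m)) * weyl_alt e m n p q.
Proof.
have E x y c : y = u * (n - m) + x + 3 * u * c -> e y = e (u * (n - m)) * e x.
  by move=> ->; rewrite !eD e_period mulr1.
set k := e (u * (n - m)) in E *.
suff -> : weyl_alt e m n (p + u) q =
    k * e ((2 * m + n) * (p + q) + (n - m) * q)
    - k * e ((2 * m + n) * (p + q) + (- m - 2 * n) * q)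
    - k * e ((n - m) * (p + q) + (2 * m + n) * q)
    + k * e ((n - m) * (p + q) + (- m - 2 * n) * q)
    + k * e ((- m - 2 * n) * (p + q) + (2 * m + n) * q)
    - k * e ((- m - 2 * n) * (p + q) + (n - m) * q).
  by rewrite /weyl_alt; ring.
by rewrite /weyl_alt; congr (_ - _ - _ + _ + _ - _); [
  by apply: (E _ _ m); ring|
  by apply: (E _ _ m); ring|
  by apply: (E _ _ 0); ring|
  by apply: (E _ _ 0); ring|
  by apply: (E _ _ (- n)); ring|
  by apply: (E _ _ (- n)); ring].
Qed.

Lemma weyl_alt_period_r m n p q :
  weyl_alt e m n p (q + u) = e (u * (n - m)) ^+ 2 * weyl_alt e m n p q.
Proof.
have E x y c : y = u * (n - m) + u * (n - m) + x + 3 * u * c ->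
    e y = e (u * (n - m)) ^+ 2 * e x.
  by move=> ->; rewrite !eD e_period mulr1 expr2.
set k := e (u * (n - m)) ^+ 2 in E *.
suff -> : weyl_alt e m n p (q + u) =
    k * e ((2 * m + n) * (p + q) + (n - m) * q)
    - k * e ((2 * m + n) * (p + q) + (- m - 2 * n) * q)
    - k * e ((n - m) * (p + q) + (2 * m + n) * q)
    + k * e ((n - m) * (p + q) + (- m - 2 * n) * q)
    + k * e ((- m - 2 * n) * (p + q) + (2 * m + n) * q)
    - k * e ((- m - 2 * n) * (p + q) + (n - m) * q).
  by rewrite /weyl_alt; ring.
by rewrite /weyl_alt; congr (_ - _ - _ + _ + _ - _); [
  by apply: (E _ _ m); ring|
  by apply: (E _ _ (m - n)); ring|
  by apply: (E _ _ m); ring|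
  by apply: (E _ _ (- n)); ring|
  by apply: (E _ _ (m - n)); ring|
  by apply: (E _ _ (- n)); ring].
Qed.

End WeylAlt.

(** * Sums over the alcove and the doubling map *)

Section AlcoveSum.
Variables (C : numFieldType) (u : nat).

(** The indices p and q are Dynkin labels shifted by rho, so the walls are excluded. *)
Definition alcove_sum (f : int -> int -> C) : C :=
  \sum_(1 <= p < u) \sum_(1 <= q < u | (p + q < u)%N) f p q.

Section Sums.
Variables (f : int -> int -> C) (chi : C).
Hypothesis f_period_l : forall p q, f (p + u%:Z) q = chi * f p q.
Hypothesis f_period_r : forall p q, f p (q + u%:Z) = chi ^+ 2 * f p q.
Hypothesis f_rot : forall p q, f q (- p - q) = f p q.
Hypothesis f_swap : forall p q, f (- q) (- p) = f p q.
Hypothesis f_wall : forall p, f p (- p) = 0.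

(** With r = u - p - q the alcove consists of the positive triples of sum u, and its rotation
    relabels them cyclically. By [f_rot] and periodicity, [f q r] is chi^2 times [f p q]. *)
Lemma alcove_sum_rot : alcove_sum f = chi ^+ 2 * alcove_sum f.
Proof.
pose G (p q r : nat) : C := if (p + q + r == u)%N then f p q else 0.
have T3 : alcove_sum f = \sum_(1 <= p < u) \sum_(1 <= q < u) \sum_(1 <= r < u) G p q r.
  rewrite /alcove_sum; apply: eq_big_nat => p hp; rewrite [LHS]big_mkcond /=.
  apply: eq_big_nat => q hq; case: ifP => pq.
    rewrite (bigD1_seq (u - (p + q))%N) ?iota_uniq ?mem_index_iota; try lia.
    rewrite {1}/G ifT; last by lia.
    rewrite big1 /= ?addr0 // => r rpq; rewrite /G ifF //; lia.
  by rewrite big_nat_cond big1 // => r; rewrite andbT => hr; rewrite /G ifF //; lia.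
rewrite T3 mulr_sumr [LHS]exchange_big_nat /=.
transitivity (\sum_(1 <= p < u) \sum_(1 <= q < u) \sum_(1 <= r < u) G q r p).
  rewrite [LHS]exchange_big_nat [RHS]exchange_big_nat /=.
  by apply: eq_bigr => q _; rewrite exchange_big_nat.
apply: eq_bigr => p _; rewrite mulr_sumr; apply: eq_bigr => q _.
rewrite mulr_sumr; apply: eq_bigr => r _; rewrite /G.
have -> : (q + r + p == u)%N = (p + q + r == u)%N by lia.
case: eqP => [E|_]; last by rewrite mulr0.
have -> : r%:Z = (- p%:Z - q%:Z) + u%:Z by lia.
by rewrite f_period_r f_rot.
Qed.

Lemma alcove_sum_eq0 : chi ^+ 3 = 1 -> chi != 1 -> alcove_sum f = 0.
Proof.
move=> chi3 chi1; have /eqP := alcove_sum_rot.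
rewrite -subr_eq0 -{1}[alcove_sum f]mul1r -mulrBl mulf_eq0 => /orP[|/eqP//].
rewrite subr_eq0 => /eqP chi2; case/eqP: chi1.
by rewrite -chi3 exprS -chi2 mulr1.
Qed.

(** The square splits into the alcove, the diagonal p + q = u, where f vanishes, and a second
    triangle, which the reflection (p, q) -> (u - q, u - p) carries onto the alcove. *)
Lemma alcove_sum_square : chi = 1 ->
  \sum_(1 <= p < u) \sum_(1 <= q < u) f p q = 2 * alcove_sum f.
Proof.
move=> chi1; rewrite mulr_natl mulr2n.
transitivity (alcove_sum f +
    \sum_(1 <= p < u) \sum_(1 <= q < u | (u < p + q)%N) f p q).
  rewrite -big_split; apply: eq_bigr => p _ /=.
  rewrite (bigID (fun q => (p + q < u)%N)) /=; congr (_ + _).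
  rewrite [LHS]big_mkcond [RHS]big_mkcond /=; apply: eq_bigr => q _.
  case: ltngtP => //= pq.
  have -> : q%:Z = - p%:Z + u%:Z by lia.
  by rewrite f_period_r f_wall mulr0.
congr (_ + _); rewrite /alcove_sum big_nat_rev /=.
rewrite [RHS](exchange_big_dep_nat xpredT) //=.
apply: eq_big_nat => p hp; rewrite big_nat_rev /=; rewrite big_nat_cond [RHS]big_nat_cond.
apply: eq_big => [q|q hq]; first by lia.
have -> : (1 + u - p.+1)%N%:Z = - p%:Z + u%:Z by lia.
have -> : (1 + u - q.+1)%N%:Z = - q%:Z + u%:Z by lia.
by rewrite f_period_l f_period_r chi1 expr1n !mul1r f_swap.
Qed.

End Sums.

Hypothesis u_odd : odd u.

Lemma periodic_sum_double (h : int -> C) :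
  (forall x, h (x + u%:Z) = h x) -> h 0 = 0 ->
  \sum_(1 <= p < u) h (2 * p%:Z) = \sum_(1 <= p < u) h p.
Proof.
move=> hper h0; have u0 : (0 < u)%N by lia.
have hmod (n : nat) : h n%:Z = h (n %% u)%N%:Z.
  rewrite {1}(divn_eq n u); elim: (n %/ u)%N => [|k IH]; first by rewrite mul0n.
  by rewrite -IH -[RHS]hper mulSn -addnA addnC PoszD.
have full (g : int -> C) : g 0 = 0 ->
    \sum_(1 <= p < u) g p = \sum_(p < u) g p%:Z.
  move=> g0; rewrite -(big_mkord xpredT (fun p => g p%:Z)).
  by rewrite [RHS]big_ltn // g0 add0r.
rewrite (full (fun x => h (2 * x))) ?mulr0 // full //.
pose d (p : 'I_u) : 'I_u := Ordinal (ltn_pmod (2 * p) u0).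
have dI : injective d.
  (* As u is odd, (u + 1)/2 is the inverse of 2 modulo u. *)
  have halve (x : 'I_u) : (x = ((2 * x) %% u * (u.+1)./2) %% u :> nat)%N.
    rewrite modnMml; have -> : (2 * x * u.+1./2 = x * u + x)%N.
      have E : (u.+1 = 2 * u.+1./2)%N by lia.
      by rewrite mulnAC -E mulnC mulnS addnC.
    by rewrite modnMDl modn_small.
  move=> p q /(congr1 val) /= pq; apply: val_inj => /=.
  by rewrite [LHS]halve pq -halve.
rewrite [RHS](reindex_inj dI); apply: eq_bigr => p _ /=.
by rewrite -hmod; congr h; lia.
Qed.

(** The doubled function has the same symmetries with chi^2 in place of chi, so for chi <> 1 both
    sums vanish. For chi = 1 the sums over the square agree, doubling one variable at a time. *)
Lemma alcove_sum_double (f : int -> int -> C) chi :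
  (forall p q, f (p + u%:Z) q = chi * f p q) ->
  (forall p q, f p (q + u%:Z) = chi ^+ 2 * f p q) ->
  (forall p q, f q (- p - q) = f p q) ->
  (forall p q, f (- q) (- p) = f p q) ->
  (forall p, f p 0 = 0) -> (forall p, f p (- p) = 0) -> (forall q, f 0 q = 0) ->
  chi ^+ 3 = 1 ->
  alcove_sum (fun p q => f (2 * p) (2 * q)) = alcove_sum f
  /\ (chi != 1 -> alcove_sum f = 0).
Proof.
move=> fl fr frot fswap f0r fN f0l chi3.
pose f2 p q := f (2 * p) (2 * q).
have f2l p q : f2 (p + u%:Z) q = chi ^+ 2 * f2 p q.
  by rewrite /f2 mulrDr [2 * u%:Z]mulr_natl mulr2n addrA !fl expr2 mulrA.
have f2r p q : f2 p (q + u%:Z) = (chi ^+ 2) ^+ 2 * f2 p q.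
  by rewrite /f2 mulrDr [2 * u%:Z]mulr_natl mulr2n addrA !fr !expr2 !mulrA.
have f2rot p q : f2 q (- p - q) = f2 p q by rewrite /f2 -[RHS]frot; congr f; ring.
have f2swap p q : f2 (- q) (- p) = f2 p q by rewrite /f2 -[RHS]fswap !mulrN.
have f2N p : f2 p (- p) = 0 by rewrite /f2 mulrN fN.
have [chi1|chi1] := eqVneq chi 1; last first.
  have z := alcove_sum_eq0 fr frot chi3 chi1.
  split=> //; rewrite z (alcove_sum_eq0 f2r f2rot) //.
    by rewrite -exprM mulnC exprM chi3 expr1n.
  by apply: contra_neq chi1 => c2; rewrite -chi3 exprS c2 mulr1.
split=> //; apply: (@mulfI _ 2); first by rewrite pnatr_eq0.
rewrite -(alcove_sum_square f2l f2r) ?chi1 ?expr1n //.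
rewrite -(alcove_sum_square fl fr) //.
transitivity (\sum_(1 <= p < u) \sum_(1 <= q < u) f p (2 * q%:Z)).
  rewrite exchange_big_nat [RHS]exchange_big_nat /=; apply: eq_bigr => q _.
  apply: (periodic_sum_double (h := f^~ (2 * q%:Z))) => // x.
  by rewrite fl chi1 mul1r.
apply: eq_bigr => p _; apply: (periodic_sum_double (h := f p)) => // x.
by rewrite fr chi1 expr1n mul1r.
Qed.

End AlcoveSum.

(** * Dynkin labels and sums over weights *)

Section Weights.
Variable l : nat.

Lemma label_sum (la : Pge l) : (val la ord0 + label1 la + label2 la = l)%N.
Proof.
have /eqP := valP la; rewrite !big_ord_recl big_ord0 addn0 addnA.
by rewrite /label1 /label2; congr (_ + _ + _ = _)%N; congr (nat_of_ord (val la _));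
   apply: val_inj.
Qed.

Lemma label_le (la : Pge l) : (label1 la + label2 la <= l)%N.
Proof. by have := label_sum la; lia. Qed.

Lemma label_inj (la mu : Pge l) :
  label1 la = label1 mu -> label2 la = label2 mu -> la = mu.
Proof.
move=> h1 h2; apply: val_inj; apply/ffunP => i; apply: val_inj.
have h0 : val la ord0 = val mu ord0 :> nat.
  by have := label_sum la; have := label_sum mu; lia.
case: i => -[|[|[|//]]] hi.
- by rewrite (_ : Ordinal hi = ord0) //; apply: val_inj.
- by rewrite (_ : Ordinal hi = @Ordinal 3 1 isT) //; apply: val_inj.
- by rewrite (_ : Ordinal hi = @Ordinal 3 2 isT) //; apply: val_inj.
Qed.

Lemma weight_exists a b : (a + b <= l)%N ->
  exists la : Pge l, label1 la = a /\ label2 la = b.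
Proof.
move=> ab.
pose f : {ffun 'I_3 -> 'I_l.+1} := [ffun i : 'I_3 => inord (nth 0 [:: l - (a + b); a; b] i)]%N.
have hf : (\sum_(i < 3) f i == l)%N.
  by rewrite !big_ord_recl big_ord0 !ffunE /= !inordK; lia.
by exists (exist _ f hf); rewrite /label1 /label2 /= !ffunE /= !inordK; lia.
Qed.

Lemma label1_vac : label1 (Pge_vac l) = 0%N.
Proof. by rewrite /label1 /= ffunE. Qed.

Lemma label2_vac : label2 (Pge_vac l) = 0%N.
Proof. by rewrite /label2 /= ffunE. Qed.

End Weights.

Lemma sum_weights_alcove (C : numFieldType) (u : nat) (G : int -> int -> C) : (3 <= u)%N ->
  \sum_(La : Pge (u - 3)) G (label1 La).+1%:Z (label2 La).+1%:Z = alcove_sum u G.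
Proof.
move=> u3; pose Q (La : Pge (u - 3)) p q := ((label1 La).+1 == p) && ((label2 La).+1 == q).
transitivity (\sum_(1 <= p < u) \sum_(1 <= q < u | (p + q < u)%N)
    \sum_(La : Pge (u - 3) | Q La p q) G p%:Z q%:Z); last first.
  apply: eq_big_nat => p hp; rewrite [LHS]big_nat_cond [RHS]big_nat_cond.
  apply: eq_bigr => q /andP[hq pq].
  have [|La [h1 h2]] := @weight_exists (u - 3) p.-1 q.-1; first by lia.
  rewrite (big_pred1 La) // => mu; rewrite /Q /=.
  apply/andP/eqP => [[/eqP m1 /eqP m2]|->]; last by rewrite h1 h2; lia.
  by apply: label_inj; lia.
pose F (La : Pge (u - 3)) p q := if (p + q < u)%N && Q La p q then G p%:Z q%:Z else 0.
transitivity (\sum_(La : Pge (u - 3)) \sum_(1 <= p < u) \sum_(1 <= q < u) F La p q).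
  apply: eq_bigr => La _; have := label_le La => hLa.
  rewrite (bigD1_seq (label1 La).+1) ?iota_uniq ?mem_index_iota; try by lia.
  rewrite (bigD1_seq (label2 La).+1) ?iota_uniq ?mem_index_iota; try by lia.
  rewrite {1}/F ifT /Q ?eqxx ?andbT; last by lia.
  rewrite /= !big1 /= ?addr0 // => [p hp|q hq].
    by rewrite big1 // => q _; rewrite /F ifF // /Q eq_sym (negbTE hp) andbF.
  by rewrite /F ifF // /Q [X in _ && (_ && X)]eq_sym (negbTE hq) !andbF.
rewrite exchange_big /=; apply: eq_bigr => p _.
rewrite exchange_big /= [RHS]big_mkcond; apply: eq_bigr => q _.
have [pq|pq] := ifP; last by rewrite big1 // => La _; rewrite /F pq.
by rewrite [RHS]big_mkcond; apply: eq_bigr => La _; rewrite /F pq.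
Qed.

(** * Comparison of the two Verlinde sums *)

Section Verlinde.
Variable R : realType.

(** This is the Leibniz formula, since [expi] turns the pairing into a product; inverting w matches
    the convention of [weyl]. *)
Lemma weyl_sum_det (l : nat) (a : R) (la La : Pge l) :
  weyl_sum a la La =
  \det (\matrix_(i < 3, j < 3) expi (- a * (plus_rho R la 0 j * plus_rho R La 0 i))).
Proof.
rewrite /weyl_sum (reindex_inj invg_inj) /determinant; apply: eq_bigr => w _ /=.
rewrite odd_permV; congr (_ * _).
have expi_sum (r : seq 'I_3) (g : 'I_3 -> R) :
    expi (\sum_(i <- r) g i) = \prod_(i <- r) expi (g i).
  elim: r => [|i r IH]; first by rewrite !big_nil expi0.
  by rewrite !big_cons expiD IH.
rewrite /pairing mulr_sumr expi_sum; apply: eq_bigr => i _.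
by rewrite !mxE invgK.
Qed.

(** The coordinates of la + rho are those of y divided by 3, whence a / 3; those of La + rho become
    x after adding (p + 2q)/3 to each. *)
Lemma weyl_sumE (l : nat) (a : R) (la La : Pge l) :
  weyl_sum a la La =
  weyl_alt (fun k : int => expi (- (a / 3) * k%:~R))
    (label1 la).+1 (label2 la).+1 (label1 La).+1 (label2 La).+1.
Proof.
pose y (m n : R) (i : nat) := nth 0 [:: (2 * m + n) / 3; (n - m) / 3; (- m - 2 * n) / 3] i.
have rhoE (mu : Pge l) (i : 'I_3) :
    plus_rho R mu 0 i = y (label1 mu).+1%:R (label2 mu).+1%:R i.
  by rewrite !mxE; case: i => -[|[|[|//]]] hi; rewrite -!val_eqE /y /=; field.
rewrite weyl_sum_det.
set m : R := (label1 la).+1%:R; set n : R := (label2 la).+1%:R.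
set p : R := (label1 La).+1%:R; set q : R := (label2 La).+1%:R.
pose f (i j : nat) := expi (- a * (y m n j * y p q i)).
transitivity (\det (\matrix_(i < 3, j < 3) f i j)).
  by congr (\det _); apply/matrixP => i j; rewrite [LHS]mxE [RHS]mxE !rhoE.
rewrite det_fun33 /f !mulrBr !mulrA -!expiD opprD opprK !addrA.
by rewrite /weyl_alt /y /=; congr (expi _ - expi _ - expi _ + expi _ + expi _ - expi _);
  rewrite /m /n /p /q; field.
Qed.

End Verlinde.

(** The column phase enters each summand as y y conj(y) / y = 1, while the row factors do not depend
    on [La] and leave the sum. *)
Lemma verlinde_phase (R : realType) (l : nat) (S A : Pge l -> Pge l -> R[i])
    (k : R[i]) (x y : Pge l -> R[i]) :
  k != 0 -> x (Pge_vac l) != 0 -> (forall La, y La * (y La)^*%C = 1) ->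
  (forall la La, S la La = k * x la * y La * A la La) ->
  forall la mu nu, verlinde S la mu nu =
    k * k^*%C * (x la * x mu * (x nu)^*%C / x (Pge_vac l)) * verlinde A la mu nu.
Proof.
move=> k0 x0 yy SE la mu nu; rewrite /verlinde mulr_sumr; apply: eq_bigr => La _.
rewrite !SE !rmorphM /= !invfM.
(* Abstracting this inverse lets [field] run without a side condition on the denominator. *)
set iv := (A (Pge_vac l) La)^-1; set kc := k^*%C; set xc := (x nu)^*%C.
set ac := (A nu La)^*%C; set d := x (Pge_vac l).
have y0 : y La != 0.
  by apply/eqP => yE; have := yy La; rewrite yE mul0r => /eqP; rewrite eq_sym oner_eq0.
have -> : (y La)^*%C = (y La)^-1 by apply: (mulfI y0); rewrite yy divff.
by field; rewrite k0 x0 y0.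
Qed.

Section VerlindeEq.
Variables (R : realType) (u : nat).
Hypotheses (u3 : (3 <= u)%N) (u_odd : odd u).

(** This is exp (-2 pi i k / (3u)); the 3 clears the denominators of pairings of weights. *)
Definition root_char (k : int) : R[i] := expi (- (2 * pi / u%:R / 3) * k%:~R).
Local Notation e := root_char.
Local Notation e' := (fun k => e (- k)).

Lemma root_charD x y : e (x + y) = e x * e y.
Proof. by rewrite /e rmorphD /= mulrDr expiD. Qed.

Lemma root_char0 : e 0 = 1.
Proof. by rewrite /e mulr0 expi0. Qed.

Lemma root_charN x : e (- x) = (e x)^*%C.
Proof. by rewrite /e rmorphN /= mulrN expiN. Qed.

Let u0 : u%:R != 0 :> R. Proof. by rewrite pnatr_eq0; lia. Qed.

Lemma root_char_period x : e (3 * u%:Z * x) = 1.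
Proof.
rewrite -(expi_2pi R (- x)) /root_char; congr expi; rewrite !rmorphM rmorphN /=.
by move: (pi : R) => c; field.
Qed.

Lemma weyl_alt_conj m n p q : (weyl_alt e m n p q)^*%C = weyl_alt e' m n p q.
Proof. by rewrite /weyl_alt !root_charN !(rmorphB, rmorphD). Qed.

Lemma weyl_sum_A2 (la La : Pge (u - 3)) : weyl_sum (2 * pi / u%:R) la La =
  weyl_alt e (label1 la).+1 (label2 la).+1 (label1 La).+1 (label2 La).+1.
Proof. exact: weyl_sumE. Qed.

Lemma weyl_sum_BP (la La : Pge (u - 3)) : weyl_sum (4 * pi / u%:R) la La =
  weyl_alt e (label1 la).+1 (label2 la).+1
    (2 * (label1 La).+1%:Z) (2 * (label2 La).+1%:Z).
Proof.
rewrite weyl_sumE /weyl_alt /root_char.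
by congr (expi _ - expi _ - expi _ + expi _ + expi _ - expi _);
  move: (pi : R) => c; field.
Qed.

Section Labels.
Variables m1 n1 m2 n2 m3 n3 : int.

Definition fusion_summand (p q : int) : R[i] :=
  weyl_alt e m1 n1 p q * weyl_alt e m2 n2 p q * weyl_alt e' m3 n3 p q
    / weyl_alt e 1 1 p q.
Local Notation f := fusion_summand.

Let chi := e (u%:Z * (n1 - m1)) * e (u%:Z * (n2 - m2)) * e (- (u%:Z * (n3 - m3))).

Let e'D x y : e' (x + y) = e' x * e' y.
Proof. by rewrite -[LHS]/(e (- (x + y))) opprD root_charD. Qed.

Let e'_period x : e' (3 * u%:Z * x) = 1.
Proof. by rewrite -[LHS]/(e (- (3 * u%:Z * x))) -mulrN root_char_period. Qed.

(** The denominator has labels (1, 1), hence period factor 1, and only the numerator contributes to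
    [chi]. The sign under reflection occurs four times and cancels. *)
Lemma alcove_sum_fusion_summand :
  alcove_sum u (fun p q => f (2 * p) (2 * q)) = alcove_sum u f /\
  (chi != 1 -> alcove_sum u f = 0).
Proof.
apply: alcove_sum_double => //.
- move=> p q; rewrite /f !(weyl_alt_period_l root_charD root_char_period).
  rewrite (weyl_alt_period_l e'D e'_period) subrr mulr0 root_char0 mul1r /chi.
  by move: (weyl_alt _ 1 1 _ _)^-1 => d; ring.
- move=> p q; rewrite /f !(weyl_alt_period_r root_charD root_char_period).
  rewrite (weyl_alt_period_r e'D e'_period) subrr mulr0 root_char0 expr1n mul1r /chi.
  by move: (weyl_alt _ 1 1 _ _)^-1 => d; ring.
- by move=> p q; rewrite /f !weyl_alt_rot.
- by move=> p q; rewrite /f !weyl_alt_swap invrN !(mulrN, mulNr) !opprK.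
- by move=> p; rewrite /f weyl_alt0r !mul0r.
- by move=> p; rewrite /f weyl_altN !mul0r.
- by move=> p; rewrite /f weyl_alt0l !mul0r.
rewrite /chi !exprMn !exprS !expr0 !mulr1 -!root_charD.
rewrite -(root_char_period ((n1 - m1) + (n2 - m2) - (n3 - m3))).
by congr e; ring.
Qed.

End Labels.

(** Modulo 3 this is, up to sign, the class of the weight modulo the root lattice. *)
Definition triality (la : Pge (u - 3)) : int := (label2 la).+1%:Z - (label1 la).+1%:Z.

(** The phase from the J_0-eigenvalue is the inverse of the period factor of [weyl_alt]; this ties
    the phases of [S_BP] to [chi]. *)
Lemma expi_jwt (la : Pge (u - 3)) :
  expi (2 * pi * jwt R la) = e (- (u%:Z * triality la)).
Proof.
rewrite /root_char /jwt /triality; congr expi.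
by rewrite rmorphN rmorphM rmorphB /=; move: (pi : R) => c; field.
Qed.

Lemma weyl_sum_A2_conj (la La : Pge (u - 3)) : (weyl_sum (2 * pi / u%:R) la La)^*%C =
  weyl_alt e' (label1 la).+1 (label2 la).+1 (label1 La).+1 (label2 La).+1 :> R[i].
Proof. by rewrite weyl_sum_A2 weyl_alt_conj. Qed.

Lemma weyl_sum_BP_conj (la La : Pge (u - 3)) : (weyl_sum (4 * pi / u%:R) la La)^*%C =
  weyl_alt e' (label1 la).+1 (label2 la).+1
    (2 * (label1 La).+1%:Z) (2 * (label2 La).+1%:Z) :> R[i].
Proof. by rewrite weyl_sum_BP weyl_alt_conj. Qed.

Definition S_norm : R[i] := 'i%C / (Num.sqrt 3 * u%:R)%:C%C.

Lemma S_norm_neq0 : S_norm != 0.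
Proof.
rewrite /S_norm mulf_neq0 ?invr_eq0 //.
  by rewrite eq_complex /= oner_eq0 andbF.
by rewrite eq_complex /= eqxx andbT mulf_neq0 // sqrtr_eq0 -ltNge.
Qed.

Lemma S_BP_phase (la La : Pge (u - 3)) : S_BP R la La =
  S_norm * expi (2 * pi * jwt R la) * expi (2 * pi * (jwt R La - u%:R / 3))
    * weyl_sum (4 * pi / u%:R) la La.
Proof.
rewrite /S_BP -/S_norm; congr (_ * _); rewrite -[RHS]mulrA -expiD; congr (_ * expi _).
by rewrite -mulrDr addrA.
Qed.

(** The sums differ by doubling and by the factor conj(chi): either chi = 1 or both vanish. The sign
    of the A_2 prefactor drops out of k conj(k). *)
Theorem verlinde_BP_A2 (la mu nu : Pge (u - 3)) :
  verlinde (@S_BP R u) la mu nu = verlinde (@S_A2 R u) la mu nu.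
Proof.
pose f := fusion_summand (label1 la).+1 (label2 la).+1 (label1 mu).+1 (label2 mu).+1
  (label1 nu).+1 (label2 nu).+1.
have A2E : verlinde (@S_A2 R u) la mu nu = S_norm * S_norm^*%C * alcove_sum u f.
  rewrite (@verlinde_phase _ _ _ (weyl_sum (2 * pi / u%:R)) (- S_norm)
    (fun=> 1) (fun=> 1)) ?oppr_eq0 ?S_norm_neq0 ?oner_eq0 //.
  - rewrite rmorphN rmorph1 mulrNN !mulr1 divr1 mulr1; congr (_ * _).
    rewrite -sum_weights_alcove //; apply: eq_bigr => La _.
    by rewrite weyl_sum_A2_conj !weyl_sum_A2 label1_vac label2_vac.
  - by move=> La; rewrite rmorph1 mulr1.
  - by move=> mu' La; rewrite /S_A2 !mulr1 mulNr.
have BPE : verlinde (@S_BP R u) la mu nu = S_norm * S_norm^*%C *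
    (e (u%:Z * triality la) * e (u%:Z * triality mu) * e (- (u%:Z * triality nu)))^*%C *
    alcove_sum u (fun p q => f (2 * p) (2 * q)).
  rewrite (@verlinde_phase _ _ _ (weyl_sum (4 * pi / u%:R)) S_norm
    (fun la => expi (2 * pi * jwt R la)) (fun La => expi (2 * pi * (jwt R La - u%:R / 3))))
    ?S_norm_neq0 ?expi_neq0 //.
  - rewrite -sum_weights_alcove //; congr (_ * _ * _).
      rewrite !expi_jwt {4}/triality label1_vac label2_vac subrr mulr0 oppr0 root_char0.
      by rewrite divr1 !root_charN !rmorphM.
    apply: eq_bigr => La _.
    by rewrite weyl_sum_BP_conj !weyl_sum_BP label1_vac label2_vac.
  - by move=> La; rewrite expi_conj.
  - by move=> mu' La; rewrite S_BP_phase.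
have [dbl zero] := alcove_sum_fusion_summand (label1 la).+1 (label2 la).+1
  (label1 mu).+1 (label2 mu).+1 (label1 nu).+1 (label2 nu).+1.
rewrite A2E BPE dbl.
set chi := e _ * _ * _; have [->|/zero] := eqVneq chi 1; first by rewrite rmorph1 mulr1.
by rewrite -/f => ->; rewrite !mulr0.
Qed.

End VerlindeEq.

(** * Uniqueness of the dimension of spaces of intertwining operators *)

Section IntertwiningDimension.
Variables (F : numFieldType) (V : vertexAlg F) (omega : V) (M1 M2 : vmodule V).

Lemma dim_intertwining_iso (M N : vmodule V) d : mod_iso M N ->
  dim_intertwining omega M1 M2 M d -> dim_intertwining omega M1 M2 N d.
Proof.
move=> /mod_iso_inverse[f [g [hf hg fK gK]]] [B [hB BU]].
exists (fun i x w1 w2 => f (B i x w1 w2)); split=> [i|Y hY].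
  exact: intertwining_comp.
have [c [cE cU]] := BU _ (intertwining_comp hg hY).
exists c; split=> [x w1 w2|c' c'E].
  by rewrite -[LHS]gK cE linear_sum; apply: eq_bigr => i _; rewrite linearZ.
apply: cU => x w1 w2; rewrite c'E linear_sum; apply: eq_bigr => i _.
by rewrite linearZ /= fK.
Qed.

Lemma dim_intertwining_le (M : vmodule V) d d' :
  dim_intertwining omega M1 M2 M d -> dim_intertwining omega M1 M2 M d' -> (d' <= d)%N.
Proof.
move=> [B [hB BU]] [B' [hB' BU']]; rewrite leqNgt; apply/negP => dd'.
pose E : lmodType F := F -> M1 -> M2 -> M.
pose s : seq E := [seq (B i : E) | i <- enum 'I_d].
have [||a a0 [j aj]] := @lin_span_dep F E s d' B'.
- by rewrite size_map size_enum_ord.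
- move=> i; have [c [cE _]] := BU _ (hB' i).
  exists d, c, (B : 'I_d -> E); split=> [k|]; first by rewrite /= map_f ?mem_enum.
  apply/funext => x; apply/funext => w1; apply/funext => w2.
  by rewrite cE !fct_sumE.
(* The zero operator is intertwining, and both the zero family and the dependency [a] expand it in
   the basis [B']. *)
have hom0 : mod_hom (\0 : {linear M -> M}).
  by move=> b n w; rewrite /= linear0.
have [c [_ cU]] := BU' _ (intertwining_comp hom0 (hB' j)).
have c0 : c = [ffun=> 0].
  by apply: cU => x w1 w2; rewrite big1 // => i _; rewrite ffunE scale0r.
have ca : c = [ffun i => a i].
  apply: cU => x w1 w2.
  have lev : linear (fun Y : E => Y x w1 w2) by [].
  have := congr1 (lin_pack lev) a0; rewrite linear_sum linear0 => E0.
  rewrite -[LHS]/(0 : M) -[LHS]E0.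
  by apply: eq_bigr => i _; rewrite ffunE linearZ.
have := congr1 (fun c : {ffun _ -> _} => c j) ca; rewrite c0 !ffunE => a0j.
by rewrite -a0j eqxx in aj.
Qed.

Lemma dim_intertwining_eq (M N : vmodule V) d d' : mod_iso M N ->
  dim_intertwining omega M1 M2 M d -> dim_intertwining omega M1 M2 N d' -> d = d'.
Proof.
move=> /dim_intertwining_iso MN /MN hd hd'; apply/eqP.
by rewrite eqn_leq (dim_intertwining_le hd' hd) (dim_intertwining_le hd hd').
Qed.

End IntertwiningDimension.

(** * Separation of the rows of the S-matrix *)

(** In this form products u k can be generalised to plain integers and the rest left to linear
    arithmetic. *)
Lemma multiple_gap (u k : int) : 0 < u -> u * k <= - u \/ u * k = 0 \/ u <= u * k.
Proof. by move=> u0; case: (ltrgtP k 0) => k0; [left|right; right|right; left]; nia. Qed.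

(* The three residues are distinct modulo 3u and their representatives sum to zero
   with spread less than 3u, which pins the representatives down. *)
Lemma weight_rigidity (u m n m' n' : int) :
  0 < m -> 0 < n -> m + n < u -> 0 < m' -> 0 < n' -> m' + n' < u ->
  (forall y, y \in [:: 2 * m' + n'; n' - m'; - m' - 2 * n'] ->
     exists2 x, x \in [:: 2 * m + n; n - m; - m - 2 * n] &
       exists k, y = x + 3 * (u * k)) ->
  m = m' /\ n = n'.
Proof.
move=> m0 n0 mnu m0' n0' mnu' H.
have [x0 hx0 [k0 e0]] := H (2 * m' + n') ltac:(by rewrite !inE eqxx).
have [x1 hx1 [k1 e1]] := H (n' - m') ltac:(by rewrite !inE eqxx orbT).
have [x2 hx2 [k2 e2]] := H (- m' - 2 * n') ltac:(by rewrite !inE eqxx !orbT).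
have u0 : 0 < u by lia.
have g01 := multiple_gap (k0 - k1) u0; have g12 := multiple_gap (k1 - k2) u0.
have g02 := multiple_gap (k0 - k2) u0.
have [g0 [g1 g2]] := (multiple_gap k0 u0, (multiple_gap k1 u0, multiple_gap k2 u0)).
move: e0 e1 e2 g01 g12 g02 g0 g1 g2; rewrite !mulrBr.
move: (u * k0) (u * k1) (u * k2) => K0 K1 K2.
move: hx0 hx1 hx2; rewrite !inE.
by case/or3P=> /eqP ->; case/or3P=> /eqP ->; case/or3P=> /eqP ->; lia.
Qed.

Section RowSeparation.
Variables (R : realType) (u : nat).
Hypotheses (u3 : (3 <= u)%N) (u_odd : odd u).
Local Notation e := (root_char R u).

Lemma root_char_eq1 x : e x = 1 -> exists k, x = 3 * (u%:Z * k).
Proof.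
move=> /expi_eq1[k kE]; exists (- k); apply: (@intr_inj R).
have pi0 : (pi : R) != 0 by rewrite gt_eqF // pi_gt0.
have u0 : u%:R != 0 :> R by rewrite pnatr_eq0; lia.
move: kE pi0; move: (pi : R) => c kE c0; rewrite !rmorphM rmorphN /=.
have -> : x%:~R = - (3 * u%:R * (- (2 * c / u%:R / 3) * x%:~R)) / (2 * c) :> R.
  by field; rewrite c0 u0.
by rewrite kE; field; rewrite c0.
Qed.

(** As u is odd, 2x = 3uk forces k to be even. *)
Lemma root_char_double_eq1 x : e (2 * x) = 1 -> exists k, x = 3 * (u%:Z * k).
Proof.
move=> /root_char_eq1[k kE]; exists (k %/ 2)%Z.
have k2 : (2 %| k)%Z.
  have : (2 %| u%:Z * k)%Z by apply/dvdzP; exists (x - u%:Z * k); lia.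
  by rewrite Gauss_dvdzr // coprimezE coprime2n.
by move/divzK: k2 => k2; rewrite -k2 in kE; nia.
Qed.

Lemma weyl_altC m n p q : weyl_alt e m n p q = weyl_alt e p q m n.
Proof.
have -> : weyl_alt e m n p q =
  e ((2 * p + q) * (m + n) + (q - p) * n)
  - e ((2 * p + q) * (m + n) + (- p - 2 * q) * n)
  - e ((q - p) * (m + n) + (2 * p + q) * n)
  + e ((- p - 2 * q) * (m + n) + (2 * p + q) * n)
  + e ((q - p) * (m + n) + (- p - 2 * q) * n)
  - e ((- p - 2 * q) * (m + n) + (q - p) * n).
  by rewrite /weyl_alt; congr (e _ - e _ - e _ + e _ + e _ - e _); ring.
by rewrite /weyl_alt; ring.
Qed.

(** At (2, 2), twice the labels of rho, the determinant is a Vandermonde determinant. At (4, 2),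
    twice those of omega_1 + rho, the Weyl character formula adds the character of the defining
    representation. *)
Lemma weyl_alt_vandermonde m n :
  let t0 := e (2 * (2 * m + n)) in let t1 := e (2 * (n - m)) in
  let t2 := e (2 * (- m - 2 * n)) in
  weyl_alt e m n 2 2 = (t0 - t1) * (t0 - t2) * (t1 - t2) /\
  weyl_alt e m n 4 2 = weyl_alt e m n 2 2 * (t0 + t1 + t2).
Proof.
move=> t0 t1 t2.
have E22 x y : e (x * (2 + 2) + y * 2) = e (2 * x) ^+ 2 * e (2 * y).
  by rewrite expr2 -!root_charD; congr e; ring.
have E42 x y : e (x * (4 + 2) + y * 2) = e (2 * x) ^+ 3 * e (2 * y).
  by rewrite !exprS expr0 mulr1 -!root_charD; congr e; ring.
by rewrite /weyl_alt !E22 !E42 -/t0 -/t1 -/t2; split; ring.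
Qed.

(** The exponents differ by 3m, 3n and 3(m + n), all strictly between 0 and 3u. *)
Lemma weyl_alt_neq0 (m n : int) : 0 < m -> 0 < n -> m + n < u%:Z ->
  weyl_alt e m n 2 2 != 0.
Proof.
move=> m0 n0 mn; have [-> _] := weyl_alt_vandermonde m n.
have gap x y : e (2 * x) = e (2 * y) -> exists k, x - y = 3 * (u%:Z * k).
  move=> xy; apply: root_char_double_eq1.
  by rewrite mulrBr root_charD xy -root_charD subrr root_char0.
have nz (x : int) : 0 < x -> x < 3 * u%:Z -> ~ exists k, x = 3 * (u%:Z * k).
  move=> x0 xu [k kE]; have u0 : 0 < u%:Z by lia.
  by have := multiple_gap k u0; move: (_ * k) kE => K; lia.
by rewrite !mulf_neq0 // subr_eq0; apply/eqP => /gap; apply: nz; lia.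
Qed.

(** The three terms are unimodular with product 1, so the second elementary symmetric function is
    the conjugate of the sum. The sum thus determines the cubic with these roots, hence the residues
    in [weight_rigidity]. *)
Lemma root_sum_rigidity (m n m' n' : int) :
  0 < m -> 0 < n -> m + n < u%:Z -> 0 < m' -> 0 < n' -> m' + n' < u%:Z ->
  e (2 * (2 * m + n)) + e (2 * (n - m)) + e (2 * (- m - 2 * n)) =
  e (2 * (2 * m' + n')) + e (2 * (n' - m')) + e (2 * (- m' - 2 * n')) ->
  m = m' /\ n = n'.
Proof.
move=> m0 n0 mnu m0' n0' mnu' sE; apply: (@weight_rigidity u%:Z) => // y yY.
pose t x := e (2 * x).
have cubic m1 n1 z : (z - t (2 * m1 + n1)) * (z - t (n1 - m1)) * (z - t (- m1 - 2 * n1)) =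
    z ^+ 3 - (t (2 * m1 + n1) + t (n1 - m1) + t (- m1 - 2 * n1)) * z ^+ 2
    + (t (2 * m1 + n1) + t (n1 - m1) + t (- m1 - 2 * n1))^*%C * z - 1.
  have c x y' z' : x = - (y' + z') -> (t x)^*%C = t y' * t z'.
    by move=> ->; rewrite /t -root_charN -root_charD; congr e; ring.
  have cD (x y' : R[i]) : (x + y')^*%C = x^*%C + y'^*%C by exact: rmorphD.
  rewrite !cD (c _ (n1 - m1) (- m1 - 2 * n1)); last by ring.
  rewrite (c _ (2 * m1 + n1) (- m1 - 2 * n1)); last by ring.
  rewrite (c _ (2 * m1 + n1) (n1 - m1)); last by ring.
  have <- : t (2 * m1 + n1) * t (n1 - m1) * t (- m1 - 2 * n1) = 1.
    by rewrite /t -!root_charD -(root_char0 R u); congr e; ring.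
  by ring.
have : (t y - t (2 * m + n)) * (t y - t (n - m)) * (t y - t (- m - 2 * n)) = 0.
  rewrite cubic /t sE -cubic; move: yY; rewrite !inE.
  by case/or3P=> /eqP ->; rewrite subrr ?mul0r ?mulr0 ?mul0r.
have rootE x : t y - t x = 0 -> exists k, y = x + 3 * (u%:Z * k).
  move=> /eqP; rewrite subr_eq0 => /eqP tE; have [|k kE] := @root_char_double_eq1 (y - x).
    by rewrite mulrBr root_charD -/(t y) tE -root_charD subrr root_char0.
  by exists k; rewrite -kE addrC subrK.
move/eqP; rewrite !mulf_eq0 => /orP[/orP[]|] /eqP/rootE h.
- by exists (2 * m + n) => //; rewrite !inE eqxx.
- by exists (n - m) => //; rewrite !inE eqxx orbT.
- by exists (- m - 2 * n) => //; rewrite !inE eqxx !orbT.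
Qed.

End RowSeparation.

(** The hypotheses say that v - w is orthogonal to v and to w, so its norm is zero. *)
Lemma gram_eq (R : rcfType) (T : finType) (v w : T -> R[i]) :
  \sum_i v i * (v i)^*%C = \sum_i v i * (w i)^*%C ->
  \sum_i w i * (v i)^*%C = \sum_i w i * (w i)^*%C -> v =1 w.
Proof.
move=> vE wE i; apply/eqP; rewrite -subr_eq0.
have ge0 (x : R[i]) : 0 <= x * x^*%C by exact: mul_conjC_ge0.
have : \sum_j (v j - w j) * (v j - w j)^*%C = 0.
  have cB (x y : R[i]) : (x - y)^*%C = x^*%C - y^*%C by exact: rmorphB.
  under eq_bigr do rewrite cB mulrBl !mulrBr.
  by rewrite !sumrB vE wE !subrr.
move/eqP; rewrite psumr_eq0 => [/allP/(_ i)|j _]; last exact: ge0.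
rewrite mem_index_enum mulf_eq0 => /(_ isT)/orP[//|].
by rewrite (fmorph_eq0 (@conjc R)).
Qed.

Section RowsDistinct.
Variables (R : realType) (u : nat).
Hypotheses (u3 : (3 <= u)%N) (u_odd : odd u).
Local Notation e := (root_char R u).

(** By symmetry of the pairing, and moving the factor 2 to the other argument, the entry is a
    Vandermonde product up to a nonzero factor. *)
Lemma S_BP_vac_neq0 (La : Pge (u - 3)) : S_BP R (Pge_vac (u - 3)) La != 0.
Proof.
suff W0 : weyl_sum (4 * pi / u%:R) (Pge_vac (u - 3)) La != 0 :> R[i].
  rewrite S_BP_phase (mulf_neq0 _ W0) // (mulf_neq0 _ (expi_neq0 _)) //.
  by rewrite (mulf_neq0 (S_norm_neq0 _ u3 u_odd)) ?expi_neq0.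
rewrite weyl_sum_BP // weyl_altC label1_vac label2_vac.
set p := Posz _; set q := Posz _.
have -> : weyl_alt e (2 * p) (2 * q) 1 1 = weyl_alt e p q 2 2.
  by rewrite /weyl_alt; congr (e _ - e _ - e _ + e _ + e _ - e _); ring.
by apply: weyl_alt_neq0 => //; have := label_le La; rewrite /p /q; lia.
Qed.

Lemma S_BP_rows_distinct (la mu : Pge (u - 3)) :
  (forall La, S_BP R la La = S_BP R mu La) -> la = mu.
Proof.
move=> rowE; have := label_le la; have := label_le mu => hmu hla.
have [u4|u4] := leqP u 3; first by apply: label_inj; lia.
have [|w1 [w11 w12]] := @weight_exists (u - 3) 1 0; first by lia.
have row0 := rowE (Pge_vac (u - 3)); have row1 := rowE w1.
rewrite !S_BP_phase !weyl_sum_BP // label1_vac label2_vac in row0.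
rewrite !S_BP_phase !weyl_sum_BP // w11 w12 in row1.
have W0 := @weyl_alt_neq0 R u u3 u_odd (label1 la).+1 (label2 la).+1
  isT isT ltac:(lia).
have [_ V1] := @weyl_alt_vandermonde R u (label1 la).+1 (label2 la).+1.
have [_ V2] := @weyl_alt_vandermonde R u (label1 mu).+1 (label2 mu).+1.
rewrite -![2 * 2]/(4 : int) -![2 * 1]/(2 : int) V1 V2 in row0 row1.
(* Dividing the entry at omega_1 by that at the vacuum removes the row phases [a], [a'] and the
   Vandermonde factors [w], [w']. *)
have cancel (a a' y z w w' s s' : R[i]) : a != 0 -> y != 0 -> z != 0 -> w != 0 ->
    a * y * w = a' * y * w' -> a * z * (w * s) = a' * z * (w' * s') -> s = s'.
  move=> a0 y0 z0 w0 E0 E1.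
  have aw : a * w = a' * w' by apply: (mulIf y0); rewrite mulrAC E0 mulrAC.
  apply: (mulfI (mulf_neq0 a0 w0)); rewrite {2}aw; apply: (mulIf z0).
  have shuffle (b c d t : R[i]) : b * c * t * d = b * d * (c * t) by ring.
  by rewrite !shuffle.
have /(root_sum_rigidity u3 u_odd) := cancel _ _ _ _ _ _ _ _
  (mulf_neq0 (S_norm_neq0 R u3 u_odd) (expi_neq0 _)) (expi_neq0 _) (expi_neq0 _) W0 row0 row1.
by move=> E; apply: label_inj; have := E isT isT ltac:(lia) isT isT ltac:(lia); lia.
Qed.

End RowsDistinct.

(** * Fusion rules of the Bershadsky-Polyakov algebra *)

Section ModulesDistinct.
Variables (R : realType) (u : nat).
Hypotheses (u3 : (3 <= u)%N) (u_odd : odd u).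
Variables (V : vertexAlg R[i]) (omega : V) (H : Pge (u - 3) -> vmodule V).
Variable N : Pge (u - 3) -> Pge (u - 3) -> Pge (u - 3) -> nat.
Hypothesis hN : forall la mu nu,
  dim_intertwining omega (H la) (H mu) (H nu) (N la mu nu).
Hypothesis hVerlinde : forall la mu nu,
  (N la mu nu)%:R = verlinde (@S_BP R u) la mu nu.

(* By the Verlinde formula the fusion coefficients with the vacuum module are the
   Hermitian inner products of the rows of the S-matrix. *)
Lemma iso_modules_eq (nu nu' : Pge (u - 3)) : mod_iso (H nu) (H nu') -> nu = nu'.
Proof.
move=> iso; pose v0 := Pge_vac (u - 3).
have gram la mu : (N la v0 mu)%:R = \sum_La S_BP R la La * (S_BP R mu La)^*%C.
  rewrite hVerlinde; apply: eq_bigr => La _.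
  by rewrite mulrAC mulfK // S_BP_vac_neq0.
have NE la : N la v0 nu = N la v0 nu' := dim_intertwining_eq iso (hN _ _ _) (hN _ _ _).
by apply: (S_BP_rows_distinct u3 u_odd); apply: (@gram_eq R _ (S_BP R nu) (S_BP R nu'));
  rewrite -[LHS]gram -[RHS]gram NE.
Qed.

End ModulesDistinct.

(** The identity holds in the universal algebra, where L is a conformal vector, and descends along
    the surjection. *)
Lemma simple_BP_transl (F : fieldType) (k : F) (V : vertexAlg F) (J L Gp Gm : V) :
  is_simple_BP k J L Gp Gm -> forall a : V, nprod L 0 a = transl a.
Proof.
move=> [_ [V0 [J0 [L0 [Gp0 [Gm0 [pi0 [[[_ [_ _ _ conf]] _] [piv pin] pir]]]]]]]].
move=> [_ piL _ _] a; have [_ [T0 _ _ _]] := conf.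
have : setT a by []; rewrite -pir => -[b _ <-].
by rewrite -piL -pin T0 /transl pin piv.
Qed.

Theorem theorem3p16 (R : realType) (u : nat) (hu3 : (3 <= u)%N) (hu_odd : odd u)
    (* V is BP(u,2), with k = -3 + u/2 *)
    (V : vertexAlg R[i]) (J L Gp Gm : V)
    (hV : is_simple_BP (- 3 + u%:R / 2) J L Gp Gm)
    (hC2 : C2_cofinite V) (hrat : va_rational L)
    (* the irreducible modules H_la *)
    (H : Pge (u - 3) -> vmodule V)
    (hH_ord : forall la, vm_ordinary L (H la))
    (hH_irr : forall la, irreducible_mod (H la))
    (hH_hw : forall la, is_hw_module J L Gp Gm (H la) (jwt _ la) (hwt _ u la))
    (hH_all : forall M : vmodule V, vm_ordinary L M -> irreducible_mod M ->
       exists la, mod_iso M (H la))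
    (* the fusion coefficients, assumed to be given by the Verlinde formula *)
    (N : Pge (u - 3) -> Pge (u - 3) -> Pge (u - 3) -> nat)
    (hN : forall la mu nu, dim_intertwining L (H la) (H mu) (H nu) (N la mu nu))
    (hVerlinde : forall la mu nu,
       (N la mu nu)%:R = verlinde (@S_BP R u) la mu nu) :
  (forall la mu,
     (exists (P : vmodule V) (Y : R[i] -> H la -> H mu -> P),
        fusion_product L Y) /\
     (forall (P : vmodule V) (Y : R[i] -> H la -> H mu -> P),
        fusion_product L Y -> iso_dsum P H (N la mu))) /\
  (forall la mu nu, (N la mu nu)%:R = verlinde (@S_A2 R u) la mu nu).
Proof.
have hT := simple_BP_transl hV.
have hI := iso_modules_eq hu3 hu_odd hN hVerlinde.
split=> [la mu|la mu nu]; last by rewrite hVerlinde verlinde_BP_A2.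
split=> [|P Y hY].
  exists (isotypic_sum H (N la mu)), (fusion_op (hN la mu)).
  exact: (fusion_product_isotypic_sum hT hrat hH_ord hH_irr hH_all hI (hN la mu)).
exact: (fusion_product_iso_dsum hT hrat hH_ord hH_irr hH_all hI (hN la mu) hY).
Qed.
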